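(* Let $f$ satisfy the standing assumptions, let $\beta=2\mu^{-1}$, $\kappa:=L/\mu$, and $\Delta_0:=h_\beta(z_0)-\bar\Phi$. Then the ACQRN method (described in the context) started at $z_0$, with $\alpha_1=2\beta\rho$ and $\alpha_2=2(3\beta L+1)\rho$, finds an $(\varepsilon,\sqrt{\kappa\rho\varepsilon})$-SOSP of $\min_{z}h_\beta(z)$ with at most $O(\sqrt{\kappa\rho}\,\Delta_0\,\varepsilon^{-3/2})$ iterations.
   Context: Write $z=(x,y)\in\mathbb{R}^n\times\mathbb{R}^m=\mathbb{R}^{n+m}$. $\|\cdot\|$ is the Euclidean norm for vectors and the spectral norm for matrices. Standing assumptions on $f:\mathbb{R}^n\times\mathbb{R}^m\to\mathbb{R}$: $f$ is thrice continuously differentiable; for each $x$, $f(x,\cdot)$ is $\mu$-strongly concave ($\mu>0$); for each $y$, $f(\cdot,y)$ is possibly nonconvex; for constants $L,\rho>0$, $\|\nabla f(z+\xi)-\nabla f(z)\|\le L\|\xi\|$ and $\|\nabla^2 f(z+\xi)-\nabla^2 f(z)\|\le\rho\|\xi\|$ for all $z,\xi\in\mathbb{R}^{n+m}$; and with $\Phi(x):=\max_{y\in\mathbb{R}^m}f(x,y)$, $\bar\Phi:=\inf_{x}\Phi(x)>-\infty$. Regularized function: $h_\beta(z):=f(z)+\frac{\beta}{2}\|\nabla_y f(z)\|^2$. Set $P:=\begin{pmatrix}0&0\\0&I_m\end{pmatrix}$ and $\bar H(z):=\nabla^2 f(z)+\beta\nabla^2 f(z)P\nabla^2 f(z)$.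 A point $z^*$ is an $(\varepsilon,\delta)$-SOSP (second-order stationary point) of $\min_z h_\beta(z)$ if $\|\nabla h_\beta(z^* )\|\le\varepsilon$ and $\nabla^2h_\beta(z^* )\succeq-\delta I_{n+m}$. ACQRN method: given $z_0$, for $k=0,1,2,\dots$ choose a global minimizer $$\xi_k\in\arg\min_{\xi\in\mathbb{R}^{n+m}}\ \nabla h_\beta(z_k)^\top\xi+\tfrac12\xi^\top\big(\bar H(z_k)+\alpha_1\|\nabla_y f(z_k)\|I_{n+m}\big)\xi+\tfrac{\alpha_2}{6}\|\xi\|^3$$ and set $z_{k+1}=z_k+\xi_k$. ''Finds with at most $T$ iterations'' means that some $z_k$ with $1\le k\le T$ has the stated property. The $O(\cdot)$ is with a universal constant, as $\varepsilon\downarrow0$ (i.e. for all sufficiently small $\varepsilon>0$ depending on the problem).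
   Formalization: The iteration bound is max(1, C√(κρ)Δ₀ε^{-3/2}), which changes only the case Δ₀ = 0, where the literal bound 0 contradicts k ≥ 1 (e.g. f = x²/2 − y²/2, z₀ = 0); the dimension m is assumed to be at least 1. *)

(* Defs.v *)
From HB Require Import structures.
From mathcomp Require Import all_boot all_order all_algebra.
From mathcomp Require Import all_classical all_reals all_analysis.
Import Order.TTheory GRing.Theory Num.Theory.
Import numFieldNormedType.Exports.

Set Implicit Arguments.
Unset Strict Implicit.
Unset Printing Implicit Defensive.

Local Open Scope classical_set_scope.
Local Open Scope ring_scope.

Section Euclidean.
Variables (R : realType) (d : nat).

Definition dotv (u v : 'cV[R]_d) : R := (u^T *m v) 0 0.

(* The library norm `|v| of a matrix is the sup norm. *)
Definition l2norm (v : 'cV[R]_d) : R := Num.sqrt (dotv v v).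

Definition spectral_norm (A : 'M[R]_d) : R :=
  sup [set l2norm (A *m v) | v in [set v | l2norm v <= 1]].

Definition qform (A : 'M[R]_d) (v : 'cV[R]_d) : R := (v^T *m A *m v) 0 0.

Definition loewner_le (A B : 'M[R]_d) : Prop :=
  forall v, 0 <= qform (B - A) v.

Definition partial (i : 'I_d) (f : 'cV[R]_d -> R) (z : 'cV[R]_d) : R :=
  'D_(delta_mx i 0) f z.

Fixpoint contdiff (k : nat) (f : 'cV[R]_d -> R) : Prop :=
  if k is k'.+1 then
    (forall z, differentiable f z) /\ (forall i, contdiff k' (partial i f))
  else continuous f.

Definition grad (f : 'cV[R]_d -> R) (z : 'cV[R]_d) : 'cV[R]_d :=
  \col_i partial i f z.

Definition hess (f : 'cV[R]_d -> R) (z : 'cV[R]_d) : 'M[R]_d :=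
  \matrix_(i, j) partial i (partial j f) z.

Definition strongly_concave (mu : R) (g : 'cV[R]_d -> R) : Prop :=
  forall (y y' : 'cV[R]_d) (t : R), 0 <= t <= 1 ->
    t * g y + (1 - t) * g y' + mu / 2 * t * (1 - t) * l2norm (y - y') ^+ 2
    <= g (t *: y + (1 - t) *: y').

Definition is_SOSP (h : 'cV[R]_d -> R) (eps delta : R) (z : 'cV[R]_d) : Prop :=
  l2norm (grad h z) <= eps /\ loewner_le (- delta%:M) (hess h z).

Definition finds_within (T : R) (z : nat -> 'cV[R]_d)
    (Q : 'cV[R]_d -> Prop) : Prop :=
  exists k : nat, [/\ (1 <= k)%N, k%:R <= T & Q (z k)].

End Euclidean.

(* A point (x, y) of R^n x R^m is the stacked column vector col_mx x y. *)
Section Minimax.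
Variables (R : realType) (n m : nat).
Implicit Types (f : 'cV[R]_(n + m) -> R) (z xi : 'cV[R]_(n + m)).

(* Strong concavity of f(x, .) makes this supremum an attained maximum. *)
Definition Phi f (x : 'cV[R]_n) : R :=
  sup (range (fun y : 'cV[R]_m => f (col_mx x y))).

Definition grad_y f z : 'cV[R]_m := dsubmx (grad f z).

Definition h_reg (beta : R) f z : R :=
  f z + beta / 2 * l2norm (grad_y f z) ^+ 2.

Definition Pmat : 'M[R]_(n + m) := block_mx 0 0 0 1%:M.

Definition Hbar (beta : R) f z : 'M[R]_(n + m) :=
  hess f z + beta *: (hess f z *m Pmat *m hess f z).

Definition cubic_model (beta alpha1 alpha2 : R) f z xi : R :=
  dotv (grad (h_reg beta f) z) xi
  + 2^-1 * qform (Hbar beta f z + (alpha1 * l2norm (grad_y f z))%:M) xi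
  + alpha2 / 6 * l2norm xi ^+ 3.

Definition ACQRN (beta alpha1 alpha2 : R) f (z : nat -> 'cV[R]_(n + m)) : Prop :=
  forall (k : nat), exists xik : 'cV[R]_(n + m),
    (forall xi, cubic_model beta alpha1 alpha2 f (z k) xik
                <= cubic_model beta alpha1 alpha2 f (z k) xi) /\
    z k.+1 = z k + xik.

End Minimax.

(* Main.v *)
Require Import Defs.
From mathcomp Require Import all_boot all_order all_algebra.
From mathcomp Require Import all_classical all_reals all_analysis.
From mathcomp Require Import ring lra.
Import Order.TTheory GRing.Theory Num.Theory.
Import numFieldNormedType.Exports.
Local Open Scope classical_set_scope.
Local Open Scope ring_scope.

Set Implicit Arguments.
Unset Strict Implicit.
Unset Printing Implicit Defensive.

(** Why the complexity bound holds.

    Write g and H for the gradient and Hessian of f, P for the projection onto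
    the y-block, r_k for the length of the k-th step and a_k = |P g(z_k)|.

    The cubic model is an upper model of h: along a step xi, the Taylor
    expansion of g bounds h(z + xi) - h(z) by the quadratic part of the model,
    plus errors of order rho r^3 and beta rho a r^2 which the cubic term and the
    term alpha1 a absorb (h_reg_le_model).  A global minimizer of a cubic
    model has value at most - alpha2 r^3 / 12 (cubic_min_value), so each
    iteration decreases h by at least kappa rho r_k^3 (h_descent).

    The stationarity and curvature conditions of that minimizer, transported
    from z_k to z_{k+1} with the Lipschitz bounds, show that at z_{k+1} the
    gradient of h is of order kappa rho r_k^2 + beta rho a_k r_k
    (grad_step_le), while the negative curvature of h is at most of order
    kappa rho r_k + beta rho (a_k + a_{k+1}) (hess_step_ge).  A short
    step, r_k <= tau with tau of order sqrt (eps / (kappa rho)), would thus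
    suffice if it were not for the terms in a_k.

    Those terms are removed by strong concavity.  Since beta = 2 / mu, the
    y-block of the gradient of h is (I + beta H_yy) g_y with
    I + beta H_yy <= - I, so that a_k <= |grad h(z_k)| (l2norm_grad_y_le);
    and h - inf Phi dominates a^2 / (2 mu) (h_reg_lower), which bounds all the a_k by
    a constant A of the problem.  A first short step therefore brings a down to
    O(sqrt eps), a second one to O(eps), and after a third one the gradient is
    at most eps and the remaining a-terms are negligible against
    sqrt (kappa rho eps), provided that eps is small: three consecutive short
    steps end at a second-order stationary point (three_short_steps).

    Counting blocks of three iterations concludes (short_step_blocks): a block
    that does not succeed contains a long step, which costs at least
    kappa rho tau^3, a fixed multiple of eps^(3/2) / sqrt (kappa rho), of the
    initial gap Delta0, and h never falls below the lower bound of Phi.  When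
    Delta0 = 0 the method cannot move and its first iterate already qualifies. *)

(** * Euclidean norm, quadratic forms and the spectral norm *)

Section EuclideanSpace.
Context {R : realType} {d : nat}.
Implicit Types (u v w : 'cV[R]_d) (A B : 'M[R]_d) (a b c t : R).

Lemma dotvE u v : dotv u v = \sum_i u i 0 * v i 0.
Proof. by rewrite /dotv mxE; apply: eq_bigr => i _; rewrite mxE. Qed.

Lemma dotvC u v : dotv u v = dotv v u.
Proof. by rewrite !dotvE; apply: eq_bigr => i _; rewrite mulrC. Qed.

Lemma dotvDl u v w : dotv (u + v) w = dotv u w + dotv v w.
Proof. by rewrite /dotv linearD mulmxDl mxE. Qed.

Lemma dotvZl a u v : dotv (a *: u) v = a * dotv u v.
Proof. by rewrite /dotv linearZ /= -scalemxAl mxE. Qed.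

Lemma dotvNl u v : dotv (- u) v = - dotv u v.
Proof. by rewrite -scaleN1r dotvZl mulN1r. Qed.

Lemma dotvBl u v w : dotv (u - v) w = dotv u w - dotv v w.
Proof. by rewrite dotvDl dotvNl. Qed.

Lemma dotv0l v : dotv 0 v = 0.
Proof. by rewrite -(scale0r v) dotvZl mul0r. Qed.

Lemma dotvDr u v w : dotv u (v + w) = dotv u v + dotv u w.
Proof. by rewrite !(dotvC u) dotvDl. Qed.

Lemma dotvZr a u v : dotv u (a *: v) = a * dotv u v.
Proof. by rewrite !(dotvC u) dotvZl. Qed.

Lemma dotvNr u v : dotv u (- v) = - dotv u v.
Proof. by rewrite !(dotvC u) dotvNl. Qed.

Lemma dotvBr u v w : dotv u (v - w) = dotv u v - dotv u w.
Proof. by rewrite dotvDr dotvNr. Qed.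

Lemma dotv0r v : dotv v 0 = 0.
Proof. by rewrite dotvC dotv0l. Qed.

Lemma dotv_mul A u v : dotv (A *m u) v = dotv u (A^T *m v).
Proof. by rewrite /dotv trmx_mul mulmxA. Qed.

Lemma dotvv_ge0 v : 0 <= dotv v v.
Proof. by rewrite dotvE sumr_ge0// => i _; rewrite -expr2 sqr_ge0. Qed.

Lemma l2norm_ge0 v : 0 <= l2norm v.
Proof. exact: sqrtr_ge0. Qed.

Lemma l2norm_sqr v : l2norm v ^+ 2 = dotv v v.
Proof. by rewrite sqr_sqrtr ?dotvv_ge0. Qed.

Lemma l2norm_eq0 v : l2norm v = 0 -> v = 0.
Proof.
move=> v0; have /eqP : dotv v v = 0 by rewrite -l2norm_sqr v0 expr0n.
rewrite dotvE psumr_eq0 => [/allP v_0|i _]; last by rewrite -expr2 sqr_ge0.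
apply/matrixP => i j; rewrite ord1 mxE; apply/eqP.
by have := v_0 i (mem_index_enum i); rewrite -expr2 sqrf_eq0.
Qed.

Lemma l2norm0 : l2norm (0 : 'cV[R]_d) = 0.
Proof. by rewrite /l2norm dotv0l sqrtr0. Qed.

Lemma l2normZ a v : l2norm (a *: v) = `|a| * l2norm v.
Proof.
by rewrite /l2norm dotvZl dotvZr mulrA -expr2 sqrtrM ?sqr_ge0// sqrtr_sqr.
Qed.

Lemma l2normN v : l2norm (- v) = l2norm v.
Proof. by rewrite -scaleN1r l2normZ normrN1 mul1r. Qed.

Lemma cauchy_schwarz u v : dotv u v <= l2norm u * l2norm v.
Proof.
have [/l2norm_eq0->|u0] := eqVneq (l2norm u) 0; first by rewrite dotv0l l2norm0 mul0r.
have [/l2norm_eq0->|v0] := eqVneq (l2norm v) 0; first by rewrite dotv0r l2norm0 mulr0.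
have uv0 : 0 < l2norm u * l2norm v.
  by rewrite mulr_gt0// lt_neqAle l2norm_ge0 eq_sym ?u0 ?v0.
(* This squared norm is 2 |u| |v| (|u| |v| - u . v). *)
have := dotvv_ge0 (l2norm v *: u - l2norm u *: v).
rewrite dotvBl !dotvBr !dotvZl !dotvZr (dotvC v u) -!l2norm_sqr => h.
rewrite -(ler_pM2l uv0); lra.
Qed.

Lemma cauchy_schwarzN u v : - (l2norm u * l2norm v) <= dotv u v.
Proof. by have := cauchy_schwarz (- u) v; rewrite dotvNl l2normN; lra. Qed.

Lemma l2normD u v : l2norm (u + v) <= l2norm u + l2norm v.
Proof.
rewrite -ler_sqr ?nnegrE ?addr_ge0 ?l2norm_ge0//.
rewrite l2norm_sqr dotvDl !dotvDr (dotvC v u) sqrrD -!l2norm_sqr.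
by have := cauchy_schwarz u v; lra.
Qed.

Lemma l2norm_le_dual v c : 0 <= c ->
  (forall u, dotv u v <= c * l2norm u) -> l2norm v <= c.
Proof.
move=> c0 /(_ v); rewrite -l2norm_sqr expr2.
have [->//|v0] := eqVneq (l2norm v) 0.
by rewrite ler_pM2r// lt_neqAle eq_sym v0 l2norm_ge0.
Qed.

Lemma dotv_delta u i : dotv u (delta_mx i 0) = u i 0.
Proof.
rewrite dotvE (bigD1 i)//= big1 => [|j ji]; first by rewrite mxE !eqxx mulr1 addr0.
by rewrite mxE (negbTE ji) mulr0.
Qed.

Lemma qformE A v : qform A v = dotv v (A *m v).
Proof. by rewrite /qform /dotv mulmxA. Qed.

Lemma qformD A B v : qform (A + B) v = qform A v + qform B v.
Proof. by rewrite !qformE mulmxDl dotvDr. Qed.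

Lemma qformN A v : qform (- A) v = - qform A v.
Proof. by rewrite !qformE mulNmx dotvNr. Qed.

Lemma qformZ a A v : qform (a *: A) v = a * qform A v.
Proof. by rewrite !qformE -scalemxAl dotvZr. Qed.

Lemma qform_scalar a v : qform a%:M v = a * l2norm v ^+ 2.
Proof. by rewrite qformE mul_scalar_mx dotvZr l2norm_sqr. Qed.

Lemma qform_sumE A v :
  qform A v = \sum_i \sum_j v i 0 * v j 0 * A i j.
Proof.
rewrite qformE dotvE; apply: eq_bigr => i _.
rewrite mxE mulr_sumr; apply: eq_bigr => j _; ring.
Qed.

Lemma qform_sum (I : finType) (F : I -> 'M[R]_d) v :
  qform (\sum_k F k) v = \sum_k qform (F k) v.
Proof.
apply: (big_morph (fun B => qform B v)) => [B B'|]; first exact: qformD.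
by rewrite qformE mul0mx dotv0r.
Qed.

Lemma qform_add B u v : B^T = B ->
  qform B (u + v) = qform B u + 2 * dotv (B *m u) v + qform B v.
Proof.
move=> Bs; rewrite !qformE mulmxDr dotvDl !dotvDr (dotvC v (B *m u)).
rewrite [dotv (B *m u) v]dotv_mul Bs; ring.
Qed.

Lemma qform_ge_of_l2norm B v (q : R) :
  l2norm (B *m v) <= q * l2norm v -> - (q * l2norm v ^+ 2) <= qform B v.
Proof.
move=> Bv; rewrite qformE; apply: le_trans (cauchy_schwarzN _ _).
by have := ler_wpM2l (l2norm_ge0 v) Bv; lra.
Qed.

Lemma l2norm_sqr_sub_ge u v (q s : R) :
  l2norm u <= s -> l2norm v <= s -> l2norm (u - v) <= q ->
  - (q * (2 * s)) <= l2norm u ^+ 2 - l2norm v ^+ 2.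
Proof.
move=> us vs uv.
have -> : l2norm u ^+ 2 - l2norm v ^+ 2 = dotv (u - v) (u + v).
  by rewrite !l2norm_sqr dotvBl !dotvDr (dotvC v u); ring.
apply: le_trans (cauchy_schwarzN _ _); rewrite lerN2.
apply: ler_pM; rewrite ?l2norm_ge0//.
by apply: le_trans (l2normD _ _) _; lra.
Qed.

(** The constant is the Frobenius norm, by Cauchy-Schwarz on each row. *)
Lemma l2norm_mul_bounded A :
  exists2 c, 0 <= c & forall v, l2norm (A *m v) <= c * l2norm v.
Proof.
exists (Num.sqrt (\sum_i l2norm (row i A)^T ^+ 2)); first exact: sqrtr_ge0.
move=> v; rewrite -ler_sqr ?nnegrE ?mulr_ge0 ?sqrtr_ge0 ?l2norm_ge0//.
rewrite exprMn (sqr_sqrtr (sumr_ge0 _ _)) => [|i _]; last exact: sqr_ge0.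
rewrite [leLHS]l2norm_sqr dotvE mulr_suml ler_sum// => i _.
rewrite -exprMn -expr2 -[leLHS]real_normK ?num_real//.
rewrite ler_sqr ?nnegrE ?mulr_ge0 ?l2norm_ge0// ler_norml.
have -> : (A *m v) i 0 = dotv (row i A)^T v.
  by rewrite dotvE mxE; apply: eq_bigr => j _; rewrite !mxE.
by rewrite cauchy_schwarzN cauchy_schwarz.
Qed.

(** The supremum defining the spectral norm is finite because the matrix is
    bounded, and it is over the unit ball, so homogeneity gives the rest. *)
Lemma l2norm_mul_spectral A v : l2norm (A *m v) <= spectral_norm A * l2norm v.
Proof.
have [/l2norm_eq0->|v0] := eqVneq (l2norm v) 0.
  by rewrite mulmx0 l2norm0 mulr0.
have vgt0 : 0 < l2norm v by rewrite lt_neqAle eq_sym v0 l2norm_ge0.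
rewrite -ler_pdivrMr//; apply: ub_le_sup.
  have [c c0 Ac] := l2norm_mul_bounded A; exists c => _ [u /= u1 <-].
  by rewrite (le_trans (Ac u))// ler_piMr.
exists ((l2norm v)^-1 *: v).
  by rewrite /= l2normZ ger0_norm ?invr_ge0 ?l2norm_ge0// mulVf.
by rewrite -scalemxAr l2normZ ger0_norm ?invr_ge0 ?l2norm_ge0// mulrC.
Qed.

End EuclideanSpace.

(** * Directional derivatives along segments *)

Section Calculus.
Context {R : realType} {d : nat}.
Implicit Types (f phi : 'cV[R]_d -> R) (u v w z : 'cV[R]_d) (c t : R).

Lemma derive_grad phi z w : differentiable phi z -> 'D_w phi z = dotv (grad phi z) w.
Proof.
move=> dphi; rewrite deriveE// {1}(_ : w = \sum_i w i 0 *: delta_mx i 0); last first.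
  rewrite {1}[w]matrix_sum_delta; apply: eq_bigr => i _.
  by rewrite big_ord1.
rewrite linear_sum dotvE; apply: eq_bigr => i _.
by rewrite linearZ /= mxE /partial deriveE// mulrC.
Qed.

Lemma is_derive_line phi z w t : (forall x, differentiable phi x) ->
  is_derive t 1 (fun s : R => phi (z + s *: w)) (dotv (grad phi (z + t *: w)) w).
Proof.
move=> dphi.
have E : (fun h : R => h^-1 *: (phi (z + (h *: 1 + t) *: w) - phi (z + t *: w))) =
  (fun h : R => h^-1 *: (phi (h *: w + (z + t *: w)) - phi (z + t *: w))).
  apply/funext => h; congr (_ *: (phi _ - _)).
  by rewrite [h *: 1]mulr1 scalerDl addrCA.
have dw : derivable phi (z + t *: w) w by exact: diff_derivable.
apply: DeriveDef; first by rewrite /derivable /= E.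
by rewrite -derive_grad// /derive /= E.
Qed.

(** One-sided difference quotients suffice to bound a directional derivative from
    below, and the quadratic error term vanishes in the limit. *)
Lemma dotv_grad_ge phi z w c K : differentiable phi z ->
  (forall t, 0 < t <= 1 -> c * t <= phi (z + t *: w) - phi z + K * t ^+ 2) ->
  c <= dotv (grad phi z) w.
Proof.
move=> dphi hc; rewrite -derive_grad//; set l := 'D_w phi z.
have cv : (fun h : R => h^-1 *: (phi (h *: w + z) - phi z)) @ 0^' --> l.
  by have := diff_derivable (v := w) dphi; rewrite /derivable.
apply/ler_addgt0Pr => e e0.
have e20 : 0 < e / 2 by rewrite divr_gt0.
move/cvgrPdist_lt : cv => /(_ _ e20)/nbhs_ballP[r /= r0 hr].
have K0 : 0 < `|K| + 1 by rewrite ltr_wpDl.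
(* t is admissible, inside the ball of radius r, and makes K t at most e / 2. *)
set t := Num.min 1 (Num.min (r / 2) (e / 2 / (`|K| + 1))).
have t0 : 0 < t by rewrite !lt_min ltr01 !divr_gt0.
have t1 : t <= 1 by rewrite ge_min lexx.
have tr : t < r.
  have : t <= r / 2 by rewrite !ge_min lexx orbT.
  by move=> /le_lt_trans; apply; rewrite ltr_pdivrMr// ltr_pMr// ltr1n.
have tK : K * t <= e / 2.
  have : t <= e / 2 / (`|K| + 1) by rewrite !ge_min lexx !orbT.
  rewrite ler_pdivlMr// mulrC; apply: le_trans.
  by rewrite ler_pM2r//; have := ler_norm K; lra.
have /hr : ball 0 r t by rewrite /ball /= sub0r normrN gtr0_norm.
move=> /(_ (lt0r_neq0 t0)); rewrite -normrN opprB => /ltr_normlW.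
have := hc t; rewrite t0 t1 (addrC z) => /(_ isT).
set D := phi _ - _ => h1 h2.
have h3 : t^-1 * D < e / 2 + l by rewrite -ltrBlDr; exact: h2.
have h4 : D < t * (e / 2 + l) by rewrite -ltr_pdivrMl.
have h5 : K * t ^+ 2 <= e / 2 * t by rewrite expr2 mulrA ler_pM2r.
by rewrite -(ler_pM2r t0); lra.
Qed.

Lemma MVT_from0 (p dp : R -> R) t : 0 < t -> (forall s : R, is_derive s 1 p (dp s)) ->
  exists2 s, 0 < s < t & p t - p 0 = dp s * t.
Proof.
move=> t0 dpE; have cp : {within `[0, t], continuous p}.
  apply/continuous_subspaceT => x.
  by apply/differentiable_continuous/derivable1_diffP; case: (dpE x).
have [s] := MVT t0 (fun x _ => dpE x) cp.
by rewrite in_itv subr0; exists s.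
Qed.

(** Every Taylor estimate below is obtained by applying this to the difference,
    along a segment, between a function and its claimed bound. *)
Lemma nonincreasing01 (p dp : R -> R) : (forall t, is_derive t 1 p (dp t)) ->
  (forall t, 0 <= t <= 1 -> dp t <= 0) -> p 1 <= p 0.
Proof.
move=> dpE dp0; have [t /andP[t0 t1]] := MVT_from0 ltr01 dpE.
rewrite mulr1 => h; have : dp t <= 0 by rewrite dp0// !ltW.
by rewrite -h subr_le0.
Qed.

(** Differentiating a component of the gradient produces the Hessian, so the
    results on scalar functions apply to the gradient through inner products. *)
Lemma grad_dotv f u z : (forall i, differentiable (partial i f) z) ->
  differentiable (fun x => dotv u (grad f x)) z /\
  grad (fun x => dotv u (grad f x)) z = hess f z *m u.
Proof.
move=> df; have -> : (fun x => dotv u (grad f x)) =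
    \sum_i (u i 0 *: (partial i f : _ -> R^o)).
  by apply/funext => x; rewrite dotvE fct_sumE; apply: eq_bigr => i _; rewrite mxE.
split; first by apply: differentiable_sum => i; exact: differentiableZ.
apply/matrixP => j k; rewrite ord1 !mxE {1}/partial derive_sum; last first.
  by move=> i; apply/derivableZ/diff_derivable.
apply: eq_bigr => i _; rewrite deriveZ; last exact: diff_derivable.
by rewrite mxE mulrC.
Qed.

Lemma contdiffW k f : contdiff k.+1 f -> contdiff k f.
Proof.
elim: k f => [|k IH] f [df dpf] /=; first by move=> z; exact: differentiable_continuous.
by split => // i; exact: IH.
Qed.

End Calculus.

(** * Symmetry of second partial derivatives *)

Section Schwarz.
Context {R : realType} {d : nat}.
Implicit Types (f phi : 'cV[R]_d -> R) (u v w z : 'cV[R]_d) (c t : R).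

Lemma is_derive_partial phi z i t : (forall x, differentiable phi x) ->
  is_derive t 1 (fun s : R => phi (z + s *: delta_mx i 0))
    (partial i phi (z + t *: delta_mx i 0)).
Proof.
by move=> dphi; have := is_derive_line z (delta_mx i 0) t dphi; rewrite dotv_delta mxE.
Qed.

(** The second difference over a small square is a value of either mixed partial,
    by two successive applications of the mean value theorem. *)
Lemma second_difference_partial phi z i j t : 0 < t ->
  (forall x, differentiable phi x) -> (forall k x, differentiable (partial k phi) x) ->
  let ei : 'cV[R]_d := delta_mx i 0 in let ej : 'cV[R]_d := delta_mx j 0 in
  exists s s', [/\ 0 < s < t, 0 < s' < t &
    phi (z + t *: ei + t *: ej) - phi (z + t *: ei) - (phi (z + t *: ej) - phi z)
    = partial j (partial i phi) (z + s *: ei + s' *: ej) * t ^+ 2].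
Proof.
move=> t0 dphi ddphi ei ej.
have dp (s : R) : is_derive s 1
    (fun s : R => phi (z + t *: ej + s *: ei) - phi (z + s *: ei))
    (partial i phi (z + t *: ej + s *: ei) - partial i phi (z + s *: ei)).
  have d1 := is_derive_partial (z + t *: ej) i s dphi.
  have d2 := is_derive_partial z i s dphi.
  exact: (is_deriveB d1 d2).
have [s s0 hs] := MVT_from0 t0 dp.
have dq (r : R) : is_derive r 1 (fun r : R => partial i phi (z + s *: ei + r *: ej))
    (partial j (partial i phi) (z + s *: ei + r *: ej)).
  exact: is_derive_partial.
have [s' s'0 hs'] := MVT_from0 t0 dq.
exists s, s'; split=> //.
rewrite expr2 mulrA -hs' scale0r addr0 (addrAC z (s *: ei)) -hs.
by rewrite !scale0r !addr0 (addrAC z (t *: ej)).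
Qed.

(** Schwarz's theorem: both mixed partials at z are limits of the same second
    difference quotient. *)
Lemma partialC phi : contdiff 2 phi ->
  forall i j z, partial i (partial j phi) z = partial j (partial i phi) z.
Proof.
move=> [dphi ddphi] i j z.
have dd k x : differentiable (partial k phi) x by case: (ddphi k).
have cont k l : continuous (partial k (partial l phi)).
  by case: (ddphi l) => _ /(_ k).
apply/eqP; rewrite -subr_eq0 -normr_le0; apply/ler_addgt0Pr => e e0; rewrite add0r.
have near k l : exists2 r, 0 < r & forall i' j' (s s' : R),
    0 < s < r -> 0 < s' < r -> `|partial k (partial l phi) z -
    partial k (partial l phi) (z + s *: delta_mx i' 0 + s' *: delta_mx j' 0)| < e / 2.
  have e20 : 0 < e / 2 by rewrite divr_gt0.
  have /cvgrPdist_lt/(_ _ e20)/nbhs_ballP[r /= r0 hr] := cont k l z.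
  exists (r / 2); first by rewrite divr_gt0.
  move=> i' j' s s' /andP[s0 sr] /andP[s'0 s'r]; apply: hr.
  rewrite -ball_normE /= -addrA opprD addNKr normrN.
  apply: le_lt_trans (ler_normD _ _) _.
  have nd (i0 : 'I_d) : `|delta_mx i0 0 : 'cV[R]_d| <= 1.
    rewrite [leLHS]/Num.Def.normr/= mx_normrE bigmax_le// => k0 _; rewrite mxE.
    by case: (_ && _); rewrite ?normr1 ?normr0.
  rewrite !normrZ !gtr0_norm//.
  have := ler_wpM2l (ltW s0) (nd i'); have := ler_wpM2l (ltW s'0) (nd j').
  by rewrite !mulr1; lra.
have [r1 r10 h1] := near i j; have [r2 r20 h2] := near j i.
set t := Num.min r1 r2; have t0 : 0 < t by rewrite lt_min r10.
have [s [s' [/andP[s0 st] /andP[s'0 s't] E1]]] := second_difference_partial z j i t0 dphi dd.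
have [q [q' [/andP[q0 qt] /andP[q'0 q't] E2]]] := second_difference_partial z i j t0 dphi dd.
have t1 : t <= r1 by rewrite ge_min lexx.
have t2 : t <= r2 by rewrite ge_min lexx orbT.
have E : partial i (partial j phi) (z + s *: delta_mx j 0 + s' *: delta_mx i 0) =
  partial j (partial i phi) (z + q *: delta_mx i 0 + q' *: delta_mx j 0).
  apply: (@mulIf _ (t ^+ 2)); first by rewrite expf_neq0// gt_eqF.
  have swap (a b c k : R) : a - b - (c - k) = a - c - (b - k) by ring.
  apply: etrans (esym E1) _; apply: etrans E2; apply: etrans (swap _ _ _ _) _.
  by rewrite [z + _ + _]addrAC.
have {}h1 : `|partial i (partial j phi) z - partial i (partial j phi)
    (z + s *: delta_mx j 0 + s' *: delta_mx i 0)| < e / 2.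
  by apply: h1; rewrite ?s0 ?s'0 (lt_le_trans _ t1).
have {}h2 : `|partial j (partial i phi) z - partial j (partial i phi)
    (z + q *: delta_mx i 0 + q' *: delta_mx j 0)| < e / 2.
  by apply: h2; rewrite ?q0 ?q'0 (lt_le_trans _ t2).
move: E h1 h2.
move: (partial i (partial j phi) _) (partial j (partial i phi) _) => X Y ->.
move: (partial i (partial j phi) z) (partial j (partial i phi) z) => a b.
move=> h1 h2; apply: le_trans (ler_distD Y _ _) _.
by rewrite (distrC Y) [leRHS]splitr lerD// ltW.
Qed.

End Schwarz.

(** * Taylor estimates under Lipschitz gradient and Hessian *)

(** On the regular module of a ring, scaling is multiplication; derivatives
    produced by the differentiation rules carry the former. *)
Lemma scale_regular {R : realType} (a b : R) : a *: (b : R^o) = a * b.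
Proof. by []. Qed.

Section LipschitzDerivatives.
Context {R : realType} {d : nat}.
Variables (f : 'cV[R]_d -> R) (L rho : R).
Hypothesis f_C3 : contdiff 3 f.
Hypothesis L_ge0 : 0 <= L.
Hypothesis rho_ge0 : 0 <= rho.
Hypothesis grad_lip : forall z xi,
  l2norm (grad f (z + xi) - grad f z) <= L * l2norm xi.
Hypothesis hess_lip : forall z xi,
  spectral_norm (hess f (z + xi) - hess f z) <= rho * l2norm xi.
Implicit Types (u v w z xi : 'cV[R]_d).

Let f_diff z : differentiable f z.
Proof. by case: f_C3. Qed.

Let partial_C2 i : contdiff 2 (partial i f).
Proof. by case: f_C3 => _ /(_ i). Qed.

Let partial_diff i z : differentiable (partial i f) z.
Proof. by case: (partial_C2 i). Qed.

Let partial2_diff i j z : differentiable (partial i (partial j f)) z.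
Proof. by case: (partial_C2 j) => _ /(_ i)[]. Qed.

Lemma partial2C i j : partial i (partial j f) = partial j (partial i f).
Proof. by apply/funext => z; exact/partialC/contdiffW. Qed.

Lemma hess_sym z : (hess f z)^T = hess f z.
Proof. by apply/matrixP => i j; rewrite !mxE partial2C. Qed.

Lemma hess_dotvC z u v : dotv (hess f z *m u) v = dotv u (hess f z *m v).
Proof. by rewrite dotv_mul hess_sym. Qed.

(** The operator bound comes from the Lipschitz bound on difference quotients of
    the gradient, tested against an arbitrary vector. *)
Lemma hess_bound z v : l2norm (hess f z *m v) <= L * l2norm v.
Proof.
apply: l2norm_le_dual => [|u]; first by rewrite mulr_ge0 ?l2norm_ge0.
have [du gu] := grad_dotv (- u) (fun i => partial_diff i z).
have : - (L * l2norm u * l2norm v) <= dotv (hess f z *m (- u)) v.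
  rewrite -gu; apply: (dotv_grad_ge (K := 0)) => // t /andP[t0 _].
  rewrite mul0r addr0 -dotvBr; apply: le_trans (cauchy_schwarzN _ _).
  rewrite l2normN mulNr lerN2.
  have := ler_wpM2l (l2norm_ge0 u) (grad_lip z (t *: v)).
  by rewrite l2normZ gtr0_norm//; lra.
by rewrite mulmxN dotvNl hess_dotvC; lra.
Qed.

Lemma hess_lip_mul z xi v :
  l2norm ((hess f (z + xi) - hess f z) *m v) <= rho * l2norm xi * l2norm v.
Proof.
by apply: le_trans (l2norm_mul_spectral _ _) _; rewrite ler_wpM2r ?l2norm_ge0.
Qed.

Lemma grad_taylor_dotv z xi u :
  dotv u (grad f (z + xi) - grad f z - hess f z *m xi)
  <= rho / 2 * l2norm xi ^+ 2 * l2norm u.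
Proof.
set c := rho / 2 * l2norm xi ^+ 2 * l2norm u.
(* The derivative of p is bounded by (rho t |xi|^2 |u| - 2 c t) = 0. *)
pose p := (fun t : R => dotv u (grad f (z + t *: xi)) - dotv u (hess f z *m xi) * t - c * t ^+ 2).
pose dp := (fun t : R => dotv (hess f (z + t *: xi) *m u) xi - dotv u (hess f z *m xi) - 2 * c * t).
have pE (t : R) : is_derive t 1 p (dp t).
  have d1 : is_derive t 1 (fun t : R => dotv u (grad f (z + t *: xi)))
      (dotv (hess f (z + t *: xi) *m u) xi).
    have [du gu] := grad_dotv u (fun i => partial_diff i (z + t *: xi)).
    rewrite -gu; apply: is_derive_line => x.
    by case: (grad_dotv u (fun i => partial_diff i x)).
  have -> : p = (fun t : R => dotv u (grad f (z + t *: xi))) -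
     (dotv u (hess f z *m xi) *: (@id R)) - (c *: (@id R) ^+ 2).
    by apply/funext => s.
  apply: is_derive_eq; rewrite /dp /= !scale_regular; ring.
have : p 1 <= p 0.
  apply: (nonincreasing01 pE) => t /andP[t0 t1].
  rewrite /dp hess_dotvC -dotvBr -mulmxBl.
  have h1 := cauchy_schwarz u ((hess f (z + t *: xi) - hess f z) *m xi).
  have := ler_wpM2l (l2norm_ge0 u) (hess_lip_mul z (t *: xi) xi).
  by rewrite l2normZ ger0_norm// /c; lra.
by rewrite /p !scale1r !scale0r addr0 !dotvBr; lra.
Qed.

Lemma grad_taylor z xi :
  l2norm (grad f (z + xi) - grad f z - hess f z *m xi) <= rho / 2 * l2norm xi ^+ 2.
Proof.
apply: l2norm_le_dual => [|u]; last exact: grad_taylor_dotv.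
by rewrite mulr_ge0 ?exprn_ge0 ?l2norm_ge0// divr_ge0.
Qed.

Lemma taylor_le z xi :
  f (z + xi) <= f z + dotv (grad f z) xi + qform (hess f z) xi / 2
                + rho / 6 * l2norm xi ^+ 3.
Proof.
set b := dotv (grad f z) xi; set q := qform (hess f z) xi; set r := l2norm xi.
(* The slope of p is nonpositive by the first-order estimate for the gradient. *)
pose p := (fun t : R => f (z + t *: xi) - b * t - q / 2 * t ^+ 2 - rho / 6 * r ^+ 3 * t ^+ 3).
pose dp := (fun t : R => dotv (grad f (z + t *: xi)) xi - b - q * t - rho / 2 * r ^+ 3 * t ^+ 2).
have pE (t : R) : is_derive t 1 p (dp t).
  have d1 := is_derive_line z xi t f_diff.
  have -> : p = (fun t : R => f (z + t *: xi)) - b *: (@id R)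
     - ((q / 2) *: (@id R) ^+ 2) - ((rho / 6 * r ^+ 3) *: (@id R) ^+ 3).
    by apply/funext => s.
  by apply: is_derive_eq; rewrite /dp /= !scale_regular; field.
have : p 1 <= p 0.
  apply: (nonincreasing01 pE) => t /andP[t0 t1].
  have := grad_taylor_dotv z (t *: xi) xi.
  rewrite dotvC !dotvBl -/b -scalemxAr dotvZl [dotv (_ *m _) _]dotvC -qformE -/q /dp.
  by rewrite l2normZ ger0_norm// -/r; lra.
by rewrite /p !scale1r !scale0r addr0; lra.
Qed.

(** Third derivatives are only controlled through the Lipschitz constant of the
    Hessian: symmetry turns the contraction of the third derivative with u into the
    directional derivative along u of the quadratic form of the Hessian. *)
Lemma third_derivative_ge z u v :
  - (rho * l2norm u * l2norm v ^+ 2) <=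
  qform (\sum_k u k 0 *: hess (partial k f) z) v.
Proof.
pose q := fun x => qform (hess f x) v.
have qE : q = \sum_i \sum_j ((v i 0 * v j 0) *: (partial i (partial j f) : _ -> R^o)).
  apply/funext => x; rewrite /q qform_sumE fct_sumE; apply: eq_bigr => i _.
  by rewrite fct_sumE; apply: eq_bigr => j _; rewrite mxE.
have dq x : differentiable q x.
  rewrite qE; apply: differentiable_sum => i; apply: differentiable_sum => j.
  exact/differentiableZ.
have partial_q k : partial k q z = qform (hess (partial k f) z) v.
  rewrite /partial qE qform_sumE derive_sum; last first.
    by move=> i; apply: derivable_sum => j; apply/derivableZ/diff_derivable.
  apply: eq_bigr => i _; rewrite derive_sum; last first.
    by move=> j; apply/derivableZ/diff_derivable.
  apply: eq_bigr => j _; rewrite deriveZ; last exact: diff_derivable.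
  have -> : hess (partial k f) z i j = partial k (partial i (partial j f)) z.
    rewrite mxE [in LHS](partial2C j k).
    exact: (partialC (partial_C2 j) i k z).
  by [].
have -> : qform (\sum_k u k 0 *: hess (partial k f) z) v = dotv (grad q z) u.
  rewrite dotvE qform_sum; apply: eq_bigr => k _.
  by rewrite qformZ mxE partial_q mulrC.
apply: (dotv_grad_ge (K := 0)) => // t /andP[t0 _].
rewrite mul0r addr0 /q -[_ - _]/(_ + - _) -qformN -qformD qformE.
apply: le_trans (cauchy_schwarzN _ _).
have := ler_wpM2l (l2norm_ge0 v) (hess_lip_mul z (t *: u) v).
by rewrite l2normZ gtr0_norm//; lra.
Qed.

End LipschitzDerivatives.

(** * Projection onto the y-block and derivatives of the regularized function *)

Section Projection.
Context {R : realType} {n m : nat}.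
Implicit Types (u v : 'cV[R]_(n + m)).
Local Notation P := (Pmat R n m).

Let Pdiag : 'rV[R]_(n + m) := row_mx 0 (const_mx 1).

(** The diagonal of the projection: 0 on the x-block and 1 on the y-block. *)
Definition Pweight (k : 'I_(n + m)) : R := Pdiag 0 k.

Let Pmat_diag : P = diag_mx Pdiag.
Proof. by rewrite diag_mx_row linear0 diag_const_mx. Qed.

Lemma Pmat_mulE r (A : 'M[R]_(n + m, r)) k j : (P *m A) k j = Pweight k * A k j.
Proof. by rewrite Pmat_diag mul_diag_mx mxE. Qed.

Lemma Pmat_mul_col v : P *m v = col_mx 0 (dsubmx v).
Proof.
rewrite -[in LHS](vsubmxK v) /Pmat mul_block_col.
by rewrite !mul0mx mul1mx !add0r.
Qed.

Lemma Pmat_idem v : P *m (P *m v) = P *m v.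
Proof. by rewrite !Pmat_mul_col col_mxKd. Qed.

Lemma Pmat_dotvC u v : dotv (P *m u) v = dotv u (P *m v).
Proof. by rewrite dotv_mul Pmat_diag tr_diag_mx. Qed.

Lemma l2norm_Pmat_le v : l2norm (P *m v) <= l2norm v.
Proof.
have := l2norm_ge0 (P *m v).
rewrite le_eqVlt => /predU1P[<-|P0]; first exact: l2norm_ge0.
rewrite -(ler_pM2l P0) -expr2 l2norm_sqr Pmat_dotvC Pmat_idem -Pmat_dotvC.
exact: cauchy_schwarz.
Qed.

Lemma dotv_col_mx (a b : 'cV[R]_n) (a' b' : 'cV[R]_m) :
  dotv (col_mx a a') (col_mx b b') = dotv a b + dotv a' b'.
Proof. by rewrite /dotv tr_col_mx mul_row_col mxE. Qed.

Lemma l2norm_dsubmx v : l2norm (dsubmx v) = l2norm (P *m v).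
Proof. by rewrite /l2norm Pmat_mul_col dotv_col_mx dotv0l add0r. Qed.

Lemma l2norm_col0 (w : 'cV[R]_m) : l2norm (col_mx (0 : 'cV[R]_n) w) = l2norm w.
Proof. by rewrite /l2norm dotv_col_mx dotv0l add0r. Qed.

End Projection.

Section RegularizedDerivatives.
Context {R : realType} {n m : nat}.
Variables (f : 'cV[R]_(n + m) -> R) (beta rho : R).
Hypothesis f_C3 : contdiff 3 f.
Hypothesis beta_ge0 : 0 <= beta.
Hypothesis rho_ge0 : 0 <= rho.
Hypothesis hess_lip : forall z xi,
  spectral_norm (hess f (z + xi) - hess f z) <= rho * l2norm xi.
Local Notation P := (Pmat R n m).
Local Notation p := Pweight.
Local Notation h := (h_reg beta f).
Implicit Types (z v : 'cV[R]_(n + m)).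

Let df z : differentiable f z.
Proof. by case: f_C3. Qed.
Let ddf i z : differentiable (partial i f) z.
Proof. by case: f_C3 => _ /(_ i)[]. Qed.
Let dddf i j z : differentiable (partial i (partial j f)) z.
Proof. by case: f_C3 => _ /(_ j)[_ /(_ i)[]]. Qed.

Lemma h_regE z : h z = f z + beta / 2 * l2norm (P *m grad f z) ^+ 2.
Proof. by rewrite /h_reg /grad_y l2norm_dsubmx. Qed.

(** With the weights of the projection, the squared norm of the partial gradient
    becomes a sum over all coordinates, which can be differentiated termwise. *)
Lemma h_reg_sum : h = f + \sum_k ((beta / 2 * p k) *: (partial k f : _ -> R^o) ^+ 2).
Proof.
apply/funext => z; rewrite h_regE l2norm_sqr Pmat_dotvC Pmat_idem dotvE.
rewrite -[RHS]/(f z + (\sum_k _) z) fct_sumE mulr_sumr; congr (_ + _).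
apply: eq_bigr => k _; rewrite Pmat_mulE mxE.
rewrite -[RHS]/(beta / 2 * p k * (partial k f z) ^+ 2); ring.
Qed.

Lemma partial_h_reg j : partial j h =
  (partial j f : _ -> R^o) + \sum_k ((beta * p k) *:
     ((partial k f : _ -> R^o) * partial j (partial k f))).
Proof.
apply/funext => z; rewrite [LHS]/partial h_reg_sum.
set e := delta_mx j 0.
have dk k : is_derive z e ((beta / 2 * p k) *: (partial k f : _ -> R^o) ^+ 2)
   ((beta * p k) *: ((partial k f z) * partial j (partial k f) z) : R^o).
  have d1 : is_derive z e (partial k f) (partial j (partial k f) z).
    by apply/derivableP/diff_derivable.
  apply: is_derive_eq; rewrite !scale_regular; field.
  by [].
have d0 : is_derive z e f (partial j f z) by apply/derivableP/diff_derivable.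
have d1 := is_derive_sum dk.
have d2 := is_deriveD d0 d1.
rewrite (@derive_val _ _ _ _ _ _ _ d2).
by rewrite -[RHS]/(partial j f z + (\sum_k _) z) fct_sumE.
Qed.

Lemma grad_h_reg z : grad h z = grad f z + beta *: (hess f z *m (P *m grad f z)).
Proof.
apply/matrixP => i j; rewrite ord1 [LHS]mxE partial_h_reg.
rewrite -[LHS]/(partial i f z + (\sum_k _) z) fct_sumE !mxE mulr_sumr.
congr (_ + _); apply: eq_bigr => k _; rewrite Pmat_mulE !mxE.
rewrite -[LHS]/(beta * p k * (partial k f z * partial i (partial k f) z)); ring.
Qed.

Lemma hess_h_reg z : hess h z =
  Hbar beta f z + beta *: \sum_k (P *m grad f z) k 0 *: hess (partial k f) z.
Proof.
apply/matrixP => i j; rewrite [LHS]mxE partial_h_reg [LHS]/partial.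
set e := delta_mx i 0.
have dk k : is_derive z e
   ((beta * p k) *: ((partial k f : _ -> R^o) * partial j (partial k f)))
   (beta * p k * (partial k f z * partial i (partial j (partial k f)) z
     + partial j (partial k f) z * partial i (partial k f) z) : R^o).
  have d1 : is_derive z e (partial k f) (partial i (partial k f) z).
    by apply/derivableP/diff_derivable.
  have d2 : is_derive z e (partial j (partial k f)) (partial i (partial j (partial k f)) z).
    by apply/derivableP/diff_derivable.
  exact: (is_deriveZ (beta * p k) (is_deriveM d1 d2)).
have d0 : is_derive z e (partial j f) (partial i (partial j f) z).
  by apply/derivableP/diff_derivable.
have d1 := is_derive_sum dk.
have d2 := is_deriveD d0 d1.
rewrite [LHS](@derive_val _ _ _ _ _ _ _ d2).
have -> : (Hbar beta f z + beta *: \sum_k (P *m grad f z) k 0 *: hess (partial k f) z) i j =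
  partial i (partial j f) z +
  (beta * \sum_k partial i (partial k f) z * (p k * partial j (partial k f) z) +
    beta * \sum_k p k * partial k f z * partial i (partial j (partial k f)) z).
  rewrite mxE /Hbar mxE [hess f z i j]mxE -addrA; congr (_ + (_ + _)).
    rewrite mxE -mulmxA mxE; congr (_ * _); apply: eq_bigr => k _.
    by rewrite Pmat_mulE -{2}(hess_sym f_C3 z) [_^T _ _]mxE ![hess _ _ _ _]mxE.
  rewrite mxE summxE; congr (_ * _); apply: eq_bigr => k _.
  by rewrite mxE Pmat_mulE !mxE.
congr (_ + _).
have regroup (b q a c k l : R) : b * q * (a * c + k * l) = b * (l * (q * k)) + b * (q * a * c).
  by ring.
rewrite !mulr_sumr; apply: etrans (eq_bigr _ (fun k _ => regroup _ _ _ _ _ _)) _.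
exact: big_split.
Qed.

(** Hbar is what remains of the Hessian of h when the third derivatives of f are
    dropped; these enter contracted with g_y only, hence the factor |g_y|. *)
Lemma qform_hess_h_reg_ge z v :
  qform (Hbar beta f z) v - beta * rho * l2norm (P *m grad f z) * l2norm v ^+ 2
  <= qform (hess h z) v.
Proof.
rewrite hess_h_reg qformD qformZ lerD2l -!mulrA -mulrN ler_wpM2l//.
by rewrite mulrA; exact: third_derivative_ge.
Qed.

End RegularizedDerivatives.

(** * Consequences of strong concavity in y *)

Section StrongConcavity.
Context {R : realType} {n m : nat}.
Variables (f : 'cV[R]_(n + m) -> R) (mu L : R).
Hypothesis f_C3 : contdiff 3 f.
Hypothesis mu_gt0 : 0 < mu.
Hypothesis L_ge0 : 0 <= L.
Hypothesis f_concave : forall x : 'cV[R]_n,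
  strongly_concave mu (fun y : 'cV[R]_m => f (col_mx x y)).
Hypothesis grad_lip : forall z xi,
  l2norm (grad f (z + xi) - grad f z) <= L * l2norm xi.
Local Notation P := (Pmat R n m).
Implicit Types (z w : 'cV[R]_(n + m)).

Let df z : differentiable f z.
Proof. by case: f_C3. Qed.
Let ddf z i : differentiable (partial i f) z.
Proof. by case: f_C3 => _ /(_ i)[]. Qed.

(** First-order form of strong concavity: let the weight t of the moved point tend
    to 0 in the definition. *)
Lemma strongly_concave_ub z w : P *m w = w ->
  f (z + w) <= f z + dotv (grad f z) w - mu / 2 * l2norm w ^+ 2.
Proof.
move=> Pw; suff : f (z + w) - f z + mu / 2 * l2norm w ^+ 2 <= dotv (grad f z) w by lra.
apply: (dotv_grad_ge (K := mu / 2 * l2norm w ^+ 2)) => // t /andP[t0 t1].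
have t01 : 0 <= t <= 1 by rewrite ltW.
have := f_concave (usubmx z) (dsubmx z + dsubmx w) (dsubmx z) t01.
rewrite [dsubmx z + _ - _]addrAC subrr add0r l2norm_dsubmx Pw.
have zwE (s : R) : col_mx (usubmx z) (dsubmx z + s *: dsubmx w) = z + s *: w.
  rewrite -[z in RHS]vsubmxK -[in RHS]Pw Pmat_mul_col scale_col_mx add_col_mx.
  by rewrite scaler0 addr0.
have -> : t *: (dsubmx z + dsubmx w) + (1 - t) *: dsubmx z = dsubmx z + t *: dsubmx w.
  by rewrite scalerDr addrAC -scalerDl (addrC t) subrK scale1r.
have := zwE 1; rewrite !scale1r => ->; rewrite zwE vsubmxK; lra.
Qed.

(** Adding the first-order inequalities at both ends of a short segment shows that
    the gradient is strongly decreasing in y; the Hessian is its derivative. *)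
Lemma strongly_concave_hess z w : P *m w = w ->
  qform (hess f z) w <= - (mu * l2norm w ^+ 2).
Proof.
move=> Pw; have [du gu] := grad_dotv (- w) (ddf z).
suff : mu * l2norm w ^+ 2 <= dotv (hess f z *m - w) w.
  by rewrite mulmxN dotvNl dotvC -qformE; lra.
rewrite -gu; apply: (dotv_grad_ge (K := 0)) => // t /andP[t0 _].
have Ptw (s : R) : P *m (s *: w) = s *: w by rewrite -scalemxAr Pw.
have h1 := strongly_concave_ub z (Ptw t).
have := strongly_concave_ub (z + t *: w) (Ptw (- t)).
rewrite scaleNr addrK l2normN dotvNr; move: h1.
rewrite !dotvZr !dotvNl !(dotvC w) l2normZ gtr0_norm// => h1 h2.
by rewrite -(ler_pM2l t0); lra.
Qed.

(** The y-block of the regularized gradient is (I + beta H_yy) g_y, and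
    strong concavity together with beta = 2 / mu makes I + beta H_yy <= - I. *)
Lemma l2norm_grad_y_le z :
  l2norm (P *m grad f z) <= l2norm (grad (h_reg (2 * mu^-1) f) z).
Proof.
set a := l2norm (P *m _); set G := grad (h_reg _ _) _.
have a0 : 0 <= a by exact: l2norm_ge0.
move: a0; rewrite le_eqVlt => /predU1P[<-|a0]; first exact: l2norm_ge0.
rewrite -(ler_pM2l a0).
have := cauchy_schwarz (P *m grad f z) (- G); rewrite l2normN -/a.
apply: le_trans; rewrite dotvNr /G grad_h_reg// dotvDr dotvZr -qformE.
have := strongly_concave_hess z (Pmat_idem (grad f z)).
have beta0 : 0 <= 2 * mu^-1 by rewrite mulr_ge0// invr_ge0 ltW.
rewrite -/a => /(ler_wpM2l beta0); rewrite mulrN.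
have -> : 2 * mu^-1 * (mu * a ^+ 2) = 2 * a ^+ 2 by field; rewrite gt_eqF.
have -> : dotv (P *m grad f z) (grad f z) = a ^+ 2.
  by rewrite l2norm_sqr [RHS]Pmat_dotvC Pmat_idem -Pmat_dotvC.
lra.
Qed.

(** Maximizing the concave upper bound over y gives Phi <= f + a^2 / (2 mu), while
    the regularization adds a^2 / mu to f; half of it is left over. *)
Lemma h_reg_lower z : has_lbound (range (Phi f)) ->
  l2norm (P *m grad f z) ^+ 2 <= 2 * mu * (h_reg (2 * mu^-1) f z - inf (range (Phi f))).
Proof.
move=> lb; set a := l2norm _.
have Phi_le : Phi f (usubmx z) <= f z + a ^+ 2 / (2 * mu).
  apply: ge_sup => [|_ [y _ <-]]; first by exists (f (col_mx (usubmx z) 0)), 0.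
  set w := col_mx (0 : 'cV[R]_n) (y - dsubmx z).
  have Pw : P *m w = w by rewrite Pmat_mul_col col_mxKd.
  have -> : col_mx (usubmx z) y = z + w.
    by rewrite -[z in RHS]vsubmxK add_col_mx addr0 addrC subrK.
  apply: le_trans (strongly_concave_ub z Pw) _.
  have := cauchy_schwarz (P *m grad f z) w.
  rewrite Pmat_dotvC Pw -/a => h.
  have := sqr_ge0 (a - mu * l2norm w) => h2.
  rewrite -addrA lerD2l ler_pdivlMr ?mulr_gt0//.
  have := ler_wpM2l (ltW mu_gt0) h; lra.
have : inf (range (Phi f)) <= f z + a ^+ 2 / (2 * mu).
  by apply: le_trans (ge_inf lb _) Phi_le; exists (usubmx z).
rewrite h_regE -/a => h.
have -> : a ^+ 2 <= 2 * mu * (f z + 2 * mu^-1 / 2 * a ^+ 2 - inf (range (Phi f))) =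
  (2 * mu * (a ^+ 2 / mu - a ^+ 2 / (2 * mu))
   <= 2 * mu * (f z + 2 * mu^-1 / 2 * a ^+ 2 - inf (range (Phi f)))).
  by congr (_ <= _); field; rewrite gt_eqF.
rewrite ler_pM2l ?mulr_gt0//.
have e : 2 * mu^-1 / 2 * a ^+ 2 = a ^+ 2 / mu by field; rewrite gt_eqF.
by rewrite e; lra.
Qed.

(** A unit vector in y has curvature at most - mu and at least - L. *)
Lemma strong_concavity_le_lipschitz : (0 < m)%N -> mu <= L.
Proof.
move=> m0; pose w : 'cV[R]_(n + m) := col_mx 0 (delta_mx (Ordinal m0) 0).
have w1 : l2norm w = 1.
  by rewrite l2norm_col0 /l2norm dotv_delta mxE !eqxx sqrtr1.
have Pw : P *m w = w by rewrite Pmat_mul_col col_mxKd.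
have := strongly_concave_hess 0 Pw; rewrite qformE w1.
have := cauchy_schwarzN w (hess f 0 *m w).
have := hess_bound f_C3 L_ge0 grad_lip 0 w; rewrite w1; lra.
Qed.

End StrongConcavity.

(** * Global minimizers of a cubic model *)

Section CubicModel.
Context {R : realType} {d : nat}.
Variables (c : 'cV[R]_d) (A : 'M[R]_d) (alpha : R) (xi : 'cV[R]_d).
Hypothesis A_sym : A^T = A.
Hypothesis alpha_ge0 : 0 <= alpha.
Let M (v : 'cV[R]_d) := dotv c v + 2^-1 * qform A v + alpha / 6 * l2norm v ^+ 3.
Hypothesis xi_min : forall v, M xi <= M v.

Let r := l2norm xi.
Let G := c + A *m xi + (alpha / 2 * r) *: xi.

(** The cube of the norm is bounded through s ^ 3 - r ^ 3 - 3 r (s ^ 2 - r ^ 2) / 2 =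
    (s - r) ^ 2 (s + r / 2), and s - r is at most the norm of the increment. *)
Lemma cubic_min_increment w :
  0 <= dotv G w + 2^-1 * qform A w + alpha / 2 * r * l2norm w ^+ 2
       + alpha / 6 * l2norm w ^+ 3.
Proof.
have := xi_min (xi + w); rewrite /M -subr_ge0 qform_add// dotvDr -/r.
set s := l2norm (xi + w); set q := l2norm w.
have s0 : 0 <= s by exact: l2norm_ge0.
have r0 : 0 <= r by exact: l2norm_ge0.
have q0 : 0 <= q by exact: l2norm_ge0.
have s2 : s ^+ 2 = r ^+ 2 + 2 * dotv xi w + q ^+ 2.
  by rewrite !l2norm_sqr dotvDl !dotvDr (dotvC w xi); ring.
have sr : s <= r + q by exact: l2normD.
have rs : r <= s + q.
  have := l2normD (xi + w) (- w); rewrite addrK l2normN; exact.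
have cube : s ^+ 3 - r ^+ 3 <= 3 * r * dotv xi w + 3 * r * q ^+ 2 + q ^+ 3.
  have -> : s ^+ 3 - r ^+ 3 = 3 / 2 * r * (s ^+ 2 - r ^+ 2) + (s - r) ^+ 2 * (s + r / 2).
    by field.
  have h1 : (s - r) ^+ 2 <= q ^+ 2.
    by rewrite -ler_sqrt ?sqr_ge0// !sqrtr_sqr (ger0_norm q0) ler_norml; apply/andP; split; lra.
  have h2 : (s - r) ^+ 2 * (s + r / 2) <= q ^+ 2 * (r * (3 / 2) + q).
    by apply: ler_pM; rewrite ?sqr_ge0//; lra.
  by rewrite s2; lra.
have a6 : 0 <= alpha / 6 by rewrite divr_ge0.
have := ler_wpM2l a6 cube.
rewrite /G !dotvDl dotvZl; lra.
Qed.

(** The increment inequality with w = - t G would fail for small t if G were not 0. *)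
Lemma cubic_min_stationary : G = 0.
Proof.
apply: l2norm_eq0; apply/eqP; rewrite eq_le l2norm_ge0 andbT leNgt; apply/negP => g0.
set g := l2norm G in g0.
(* Dividing the increment inequality for - t G by t leaves |G|^2 <= t K. *)
pose K := `|qform A G| + alpha * r * g ^+ 2 + alpha * g ^+ 3.
have r0 : 0 <= r by exact: l2norm_ge0.
have K0 : 0 <= K by rewrite !addr_ge0 ?mulr_ge0 ?exprn_ge0// ltW.
have main t : 0 < t -> t <= 1 -> g ^+ 2 <= t * K.
  move=> t0 t1; have := cubic_min_increment ((- t) *: G).
  rewrite dotvZr -l2norm_sqr -/g l2normZ normrN gtr0_norm// -/g.
  rewrite qformE -scalemxAr dotvZl dotvZr -qformE => h.
  rewrite -(ler_pM2l t0).
  have h1 := ler_norm (qform A G).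
  have h2 : t ^+ 3 <= t ^+ 2 by rewrite exprS ler_piMl// exprn_ge0// ltW.
  have h3 := ler_wpM2l (mulr_ge0 alpha_ge0 (exprn_ge0 3 (ltW g0))) h2.
  have h4 := ler_wpM2l (sqr_ge0 t) h1.
  have h5 : 0 <= alpha * r * g ^+ 2 * t ^+ 2 by rewrite !mulr_ge0 ?sqr_ge0// ltW.
  have h6 : 0 <= alpha * g ^+ 3 * t ^+ 2 by rewrite !mulr_ge0 ?sqr_ge0 ?exprn_ge0// ltW.
  have h7 : 0 <= `|qform A G| * t ^+ 2 by rewrite mulr_ge0 ?sqr_ge0.
  rewrite /K; lra.
have g2 : 0 < g ^+ 2 by rewrite exprn_gt0.
have K1 : 0 < K + g ^+ 2 + 1 by lra.
have tt : 0 < g ^+ 2 / (K + g ^+ 2 + 1) by rewrite divr_gt0.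
have := main _ tt; rewrite ler_pdivrMr// mul1r.
have -> : g ^+ 2 <= K + g ^+ 2 + 1 by lra.
move=> /(_ isT); rewrite mulrAC ler_pdivlMr// ler_pM2l//; lra.
Qed.

(** The linear term of the increment vanishes; dividing by t^2 the inequality for
    t w and letting t tend to 0 leaves the curvature bound. *)
Lemma cubic_min_curvature w : - (alpha * r * l2norm w ^+ 2) <= qform A w.
Proof.
set q := l2norm w.
have q0 : 0 <= q by exact: l2norm_ge0.
pose K := alpha / 3 * q ^+ 3.
have K0 : 0 <= K by rewrite mulr_ge0 ?exprn_ge0// divr_ge0.
rewrite -subr_ge0 opprK; apply/ler_addgt0Pr => e e0.
pose t := e / (K + 1).
have t0 : 0 < t by rewrite divr_gt0// ltr_wpDl.
have tK : t * K <= e.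
  by rewrite /t mulrAC ler_pdivrMr ?ltr_wpDl// ler_pM2l//; lra.
have := cubic_min_increment (t *: w).
rewrite cubic_min_stationary dotv0l add0r l2normZ gtr0_norm// -/q.
rewrite qformE -scalemxAr dotvZl dotvZr -qformE => h.
rewrite -(ler_pM2l (mulr_gt0 t0 t0)) mulr0.
have := ler_wpM2l (ltW (mulr_gt0 t0 t0)) tK.
by rewrite /K; lra.
Qed.

(** Comparing xi with - xi shows c . xi <= 0; the stationarity equation tested
    against xi then eliminates the quadratic form from the value. *)
Lemma cubic_min_value : M xi <= - (alpha / 12 * r ^+ 3).
Proof.
have := xi_min (- xi); rewrite /M dotvNr l2normN -/r.
have -> : qform A (- xi) = qform A xi by rewrite !qformE mulmxN dotvNl dotvNr opprK.
have : dotv G xi = 0 by rewrite cubic_min_stationary dotv0l.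
rewrite /G !dotvDl dotvZl -l2norm_sqr -/r [dotv (_ *m _) _]dotvC -qformE.
lra.
Qed.

End CubicModel.

(** * One step of the method *)

(** With H and H' the Hessians of f at the old and the new point and Q the projection,
    the left-hand side is the gradient of h at the new point minus the gradient of
    the model, which vanishes at its minimizer; the right-hand side consists of
    differences that the Lipschitz constants control, and of the step itself. *)
Lemma model_gradient_defect {R : realType} {d : nat} (H H' Q : 'M[R]_d)
    (g g' x : 'cV[R]_d) (b s t : R) :
  g' + b *: (H' *m (Q *m g')) -
    (g + b *: (H *m (Q *m g)) + (H + b *: (H *m Q *m H) + s%:M) *m x + t *: x) =
  g' - g - H *m x + b *: ((H' - H) *m (Q *m g'))
    + b *: (H *m (Q *m (g' - g - H *m x))) - (s + t) *: x.
Proof.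
rewrite mulmxBl !mulmxBr !mulmxDl mul_scalar_mx -scalemxAl -!mulmxA.
move: (H' *m _) (H *m (Q *m (H *m x))) (H *m (Q *m g')) (H *m (Q *m g)) (H *m x).
by move=> H'Pg' HPHx HPg' HPg Hx; apply/matrixP => i j; rewrite !mxE; ring.
Qed.

Lemma model_defect_le {R : realType} {d : nat} (D H Q : 'M[R]_d)
    (e p x : 'cV[R]_d) (b L k q c : R) : 0 <= b -> 0 <= L -> 0 <= k ->
  l2norm e <= c -> l2norm (D *m p) <= q ->
  (forall v, l2norm (H *m v) <= L * l2norm v) ->
  (forall v, l2norm (Q *m v) <= l2norm v) ->
  l2norm (e + b *: (D *m p) + b *: (H *m (Q *m e)) - k *: x)
  <= c + b * q + b * (L * c) + k * l2norm x.
Proof.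
move=> b0 L0 k0 ec Dq HL Q1.
apply: le_trans (l2normD _ _) _; rewrite l2normN l2normZ (ger0_norm k0) lerD2r.
apply: le_trans (l2normD _ _) _; rewrite l2normZ (ger0_norm b0).
apply: lerD; last first.
  apply: ler_wpM2l => //; apply: le_trans (HL _) _.
  by apply: ler_wpM2l => //; exact: le_trans (Q1 _) ec.
apply: le_trans (l2normD _ _) _; rewrite l2normZ (ger0_norm b0) lerD//.
exact: ler_wpM2l.
Qed.

Lemma curvature_bookkeeping {R : realType} (k1 k2 b rho L r a nv ap s s' q1 q0 : R) :
  - (k2 * r * nv ^+ 2) <= q0 + b * s + k1 * a * nv ^+ 2 ->
  - (rho * r * nv ^+ 2) <= q1 - q0 ->
  b * - (rho * r * nv * (2 * (L * nv))) <= b * (s' - s) ->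
  - ((k2 * r + k1 * a + b * rho * ap + (1 + 2 * b * L) * rho * r) * nv ^+ 2)
  <= q1 + b * s' - b * rho * ap * nv ^+ 2.
Proof. move=> h1 h2 h3; lra. Qed.

Section Step.
Context {R : realType} {n m : nat}.
Variables (f : 'cV[R]_(n + m) -> R) (beta L rho : R).
Hypothesis f_C3 : contdiff 3 f.
Hypothesis beta_ge0 : 0 <= beta.
Hypothesis L_ge0 : 0 <= L.
Hypothesis rho_ge0 : 0 <= rho.
Hypothesis grad_lip : forall z xi,
  l2norm (grad f (z + xi) - grad f z) <= L * l2norm xi.
Hypothesis hess_lip : forall z xi,
  spectral_norm (hess f (z + xi) - hess f z) <= rho * l2norm xi.
Local Notation P := (Pmat R n m).
Local Notation h := (h_reg beta f).
Local Notation gy z := (P *m grad f z).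
Local Notation alpha1 := (2 * beta * rho).
Local Notation alpha2 := (2 * (3 * beta * L + 1) * rho).
Local Notation model := (cubic_model beta alpha1 alpha2 f).
Implicit Types (z v xi : 'cV[R]_(n + m)).

Lemma qform_Hbar z v :
  qform (Hbar beta f z) v = qform (hess f z) v + beta * l2norm (P *m (hess f z *m v)) ^+ 2.
Proof.
rewrite /Hbar qformD qformZ; congr (_ + _ * _).
rewrite qformE -!mulmxA -(hess_dotvC f_C3) [RHS]l2norm_sqr.
by rewrite Pmat_dotvC Pmat_idem.
Qed.

Lemma Hbar_sym z : (Hbar beta f z)^T = Hbar beta f z.
Proof.
have PT : P^T = P by rewrite /Pmat tr_block_mx !trmx0 trmx1.
by rewrite /Hbar linearD linearZ /= !trmx_mul PT (hess_sym f_C3) mulmxA.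
Qed.

Lemma l2norm_remainder z xi :
  l2norm (grad f (z + xi) - grad f z - hess f z *m xi) <= 2 * L * l2norm xi.
Proof.
apply: le_trans (l2normD _ _) _; rewrite l2normN.
have := grad_lip z xi; have := hess_bound f_C3 L_ge0 grad_lip z xi; lra.
Qed.

(** The Taylor remainder of the gradient is bounded both by rho r ^ 2 / 2 and by
    2 L r; its square is controlled by the product of the two bounds, so that every
    error term is cubic except the one carrying the factor |g_y|. *)
Lemma h_reg_le_model z xi : h (z + xi) <= h z + model z xi.
Proof.
set r := l2norm xi; set a := l2norm (gy z).
set H := hess f z; set e := grad f (z + xi) - grad f z - H *m xi.
have r0 : 0 <= r by exact: l2norm_ge0.
have a0 : 0 <= a by exact: l2norm_ge0.
have e1 : l2norm (P *m e) <= rho / 2 * r ^+ 2.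
  exact: le_trans (l2norm_Pmat_le _) (grad_taylor f_C3 rho_ge0 hess_lip z xi).
have e2 : l2norm (P *m e) <= 2 * L * r.
  exact: le_trans (l2norm_Pmat_le _) (l2norm_remainder z xi).
have Hxi : l2norm (P *m (H *m xi)) <= L * r.
  exact: le_trans (l2norm_Pmat_le _) (hess_bound f_C3 L_ge0 grad_lip z xi).
have gE : P *m grad f (z + xi) = gy z + P *m (H *m xi) + P *m e.
  by rewrite -!mulmxDr /e [in RHS]addrC -[_ - _ - _]addrA -opprD subrK.
have sq : l2norm (gy (z + xi)) ^+ 2 <= a ^+ 2 + l2norm (P *m (H *m xi)) ^+ 2
    + 2 * dotv (H *m gy z) xi + rho * a * r ^+ 2 + 2 * L * rho * r ^+ 3.
  rewrite gE l2norm_sqr !dotvDl !dotvDr -!l2norm_sqr.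
  rewrite (dotvC (P *m e)) (dotvC (P *m e)) (dotvC (P *m (H *m xi)) (gy z)).
  rewrite -/a (hess_dotvC f_C3).
  have -> : dotv (gy z) (P *m (H *m xi)) = dotv (gy z) (H *m xi).
    by rewrite Pmat_dotvC Pmat_idem -Pmat_dotvC.
  have c1 := cauchy_schwarz (gy z) (P *m e).
  have c2 := cauchy_schwarz (P *m (H *m xi)) (P *m e).
  have c3 := ler_wpM2l a0 e1.
  have c4 : l2norm (P *m (H *m xi)) * l2norm (P *m e) <= L * r * (rho / 2 * r ^+ 2).
    by apply: ler_pM; rewrite ?l2norm_ge0.
  have c5 : l2norm (P *m e) ^+ 2 <= 2 * L * r * (rho / 2 * r ^+ 2).
    by rewrite expr2; apply: ler_pM; rewrite ?l2norm_ge0.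
  rewrite -/a in c1; lra.
have f_le := taylor_le f_C3 hess_lip z xi.
rewrite -/r -/H in f_le.
rewrite !h_regE /cubic_model (grad_h_reg beta f_C3) qformD qform_scalar qform_Hbar.
rewrite /grad_y l2norm_dsubmx -/a -/r -/H dotvDl dotvZl.
have := ler_wpM2l beta_ge0 sq.
have p1 : 0 <= rho * r ^+ 3 by rewrite mulr_ge0 ?exprn_ge0.
have p2 : 0 <= beta * (rho * a * r ^+ 2) by rewrite !mulr_ge0 ?exprn_ge0.
lra.
Qed.

Section Minimizer.
Variables (z xi : 'cV[R]_(n + m)).
Hypothesis xi_min : forall v, model z xi <= model z v.
Let r := l2norm xi.
Let a := l2norm (gy z).
Let A := Hbar beta f z + (alpha1 * l2norm (grad_y f z))%:M.

Let r0 : 0 <= r. Proof. exact: l2norm_ge0. Qed.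
Let a0 : 0 <= a. Proof. exact: l2norm_ge0. Qed.

Let alpha2_ge0 : 0 <= alpha2.
Proof. by rewrite !mulr_ge0// addr_ge0// !mulr_ge0. Qed.

Let A_sym : A^T = A.
Proof. by rewrite /A linearD /= Hbar_sym tr_scalar_mx. Qed.

Lemma h_reg_descent : h (z + xi) <= h z - (3 * beta * L + 1) * rho / 6 * r ^+ 3.
Proof.
apply: le_trans (h_reg_le_model z xi) _.
by have := cubic_min_value A_sym alpha2_ge0 xi_min; rewrite /cubic_model -/r; lra.
Qed.

(** The gradient of h at the new point is the defect between h and the model, as the
    gradient of the model vanishes. *)
Lemma grad_next_le :
  l2norm (grad h (z + xi)) <= beta * rho * r * l2norm (gy (z + xi))
    + 2 * beta * rho * a * r + (7 / 2 * beta * L + 3 / 2) * rho * r ^+ 2.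
Proof.
have stat := cubic_min_stationary A_sym alpha2_ge0 xi_min.
have aE : l2norm (grad_y f z) = a by rewrite /grad_y l2norm_dsubmx.
have E : grad h (z + xi) = grad h (z + xi) -
    (grad h z + A *m xi + (alpha2 / 2 * r) *: xi) by rewrite stat subr0.
rewrite E !(grad_h_reg beta f_C3) /A aE model_gradient_defect {E stat}.
have st0 : 0 <= alpha1 * a + alpha2 / 2 * r.
  by rewrite addr_ge0 ?mulr_ge0 ?addr_ge0 ?mulr_ge0 ?invr_ge0.
apply: le_trans (model_defect_le xi beta_ge0 L_ge0 st0
  (grad_taylor f_C3 rho_ge0 hess_lip z xi)
  (hess_lip_mul hess_lip z xi (gy (z + xi)))
  (hess_bound f_C3 L_ge0 grad_lip z) l2norm_Pmat_le) _.
by rewrite -/r; move: (l2norm (gy (z + xi))) => p; lra.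
Qed.

(** The curvature bound for the matrix of the model at z is carried to z + xi: Hbar
    moves by at most (1 + 2 beta L) rho r, and the third derivatives cost
    beta rho |g_y(z + xi)|. *)
Lemma hess_next_ge v :
  - ((alpha2 * r + alpha1 * a + beta * rho * l2norm (gy (z + xi))
     + (1 + 2 * beta * L) * rho * r) * l2norm v ^+ 2) <= qform (hess h (z + xi)) v.
Proof.
have c := cubic_min_curvature A_sym alpha2_ge0 xi_min v.
apply: le_trans (qform_hess_h_reg_ge f_C3 beta_ge0 hess_lip _ _).
rewrite /A qformD qform_scalar !qform_Hbar /grad_y l2norm_dsubmx -/a in c.
rewrite qform_Hbar.
have D := hess_lip_mul hess_lip z xi v.
have q := qform_ge_of_l2norm D; rewrite qformD qformN -/r in q.
have Hb x : l2norm (P *m (hess f x *m v)) <= L * l2norm v.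
  exact: le_trans (l2norm_Pmat_le _) (hess_bound f_C3 L_ge0 grad_lip _ _).
have PD : l2norm (P *m (hess f (z + xi) *m v) - P *m (hess f z *m v))
    <= rho * r * l2norm v.
  by rewrite -mulmxBr -mulmxBl; exact: le_trans (l2norm_Pmat_le _) D.
have p := ler_wpM2l beta_ge0 (l2norm_sqr_sub_ge (Hb (z + xi)) (Hb z) PD).
move: c q p; move: (l2norm v) (l2norm (gy (z + xi))) => nv ap c q p.
have := curvature_bookkeeping ap c q p; apply.
Qed.

End Minimizer.
End Step.

(** * Counting iterations *)

(** A block of three steps that does not succeed contains a long step; the drops of
    successive blocks add up because the sequence never increases. *)
Lemma short_step_blocks {R : realType} (hs r : nat -> R) (Q : nat -> Prop) (tau delta : R) N :
  (forall k, hs k.+1 <= hs k) ->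
  (forall k, tau < r k -> hs k.+1 <= hs k - delta) ->
  (forall k, r k <= tau -> r k.+1 <= tau -> r k.+2 <= tau -> Q k.+3) ->
  (exists k, [/\ (1 <= k)%N, (k <= 3 * N)%N & Q k]) \/
  hs (3 * N)%N <= hs 0%N - N%:R * delta.
Proof.
move=> hs_dec hs_drop succeed; elim: N => [|N [[k [k1 kN Qk]]|IH]].
- by right; rewrite muln0 mul0r subr0.
- by left; exists k; split=> //; apply: leq_trans kN _; rewrite leq_mul2l leqnSn.
rewrite mulnS addnC !addnS addn0; set j := (3 * N)%N in IH *.
have [h0|h0] := leP (r j) tau; last first.
  right; have := hs_drop _ h0; have := hs_dec j.+1; have := hs_dec j.+2.
  by rewrite -natr1; lra.
have [h1|h1] := leP (r j.+1) tau; last first.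
  right; have := hs_drop _ h1; have := hs_dec j; have := hs_dec j.+2.
  by rewrite -natr1; lra.
have [h2|h2] := leP (r j.+2) tau; last first.
  right; have := hs_drop _ h2; have := hs_dec j; have := hs_dec j.+1.
  by rewrite -natr1; lra.
by left; exists j.+3; split=> //; exact: succeed.
Qed.

Lemma grad_bookkeeping {R : realType} (q B s a' : R) :
  0 <= s ^+ 2 -> q * s * a' <= q * s * (B * s ^+ 2) ->
  2 * q * B * s * s ^+ 2 <= 1 * s ^+ 2 -> s ^+ 2 / 90 + q * s * a' <= s ^+ 2.
Proof. by move=> *; lra. Qed.

Lemma hess_bookkeeping {R : realType} (p B s sg a' a'' u : R) :
  0 <= sg * s -> u <= sg * s / 40 ->
  p * a' <= p * (B * s ^+ 2) -> p * a'' <= p * s ^+ 2 ->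
  2 * p * (2 * B + 1) * s * s <= sg * s ->
  19 * u + p * (2 * a' + a'') <= sg * s.
Proof. by move=> *; lra. Qed.

Section Convergence.
Context {R : realType} {n m : nat}.
Variables (f : 'cV[R]_(n + m) -> R) (mu L rho : R) (z : nat -> 'cV[R]_(n + m)).
Hypothesis m_gt0 : (0 < m)%N.
Hypothesis mu_gt0 : 0 < mu.
Hypothesis L_gt0 : 0 < L.
Hypothesis rho_gt0 : 0 < rho.
Hypothesis f_C3 : contdiff 3 f.
Hypothesis f_concave : forall x : 'cV[R]_n,
  strongly_concave mu (fun y : 'cV[R]_m => f (col_mx x y)).
Hypothesis grad_lip : forall z xi,
  l2norm (grad f (z + xi) - grad f z) <= L * l2norm xi.
Hypothesis hess_lip : forall z xi,
  spectral_norm (hess f (z + xi) - hess f z) <= rho * l2norm xi.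
Hypothesis Phi_lb : has_lbound (range (Phi f)).
Local Notation beta := (2 * mu^-1).
Local Notation kappa := (L / mu).
Local Notation h := (h_reg beta f).
Hypothesis z_ACQRN :
  ACQRN beta (2 * beta * rho) (2 * (3 * beta * L + 1) * rho) f z.

Definition step_length k := l2norm (z k.+1 - z k).
Definition ygrad_norm k := l2norm (Pmat R n m *m grad f (z k)).
Local Notation r := step_length.
Local Notation a := ygrad_norm.
Local Notation gap k := (h (z k) - inf (range (Phi f))).

Let beta_ge0 : 0 <= beta. Proof. by rewrite mulr_ge0 ?invr_ge0 ?ltW. Qed.
Let L_ge0 := ltW L_gt0.
Let rho_ge0 := ltW rho_gt0.
Let betaL : beta * L = 2 * kappa. Proof. by rewrite mulrAC mulrA. Qed.

Lemma step_length_ge0 k : 0 <= r k. Proof. exact: l2norm_ge0. Qed.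
Lemma ygrad_norm_ge0 k : 0 <= a k. Proof. exact: l2norm_ge0. Qed.

Lemma kappa_ge1 : 1 <= kappa.
Proof.
rewrite ler_pdivlMr// mul1r.
exact: strong_concavity_le_lipschitz f_C3 L_ge0 f_concave grad_lip m_gt0.
Qed.

Lemma z_next k : z k.+1 = z k + (z k.+1 - z k).
Proof. by rewrite addrC subrK. Qed.

Lemma z_min k v :
  cubic_model beta (2 * beta * rho) (2 * (3 * beta * L + 1) * rho) f (z k) (z k.+1 - z k)
  <= cubic_model beta (2 * beta * rho) (2 * (3 * beta * L + 1) * rho) f (z k) v.
Proof. by have [xi [xi_min ->]] := z_ACQRN k; rewrite [z k + _]addrC addrK. Qed.

Lemma h_descent k : h (z k.+1) <= h (z k) - kappa * rho * r k ^+ 3.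
Proof.
have := h_reg_descent f_C3 beta_ge0 L_ge0 rho_ge0 grad_lip hess_lip (@z_min k).
rewrite -z_next -/(r k) -(mulrA 3) betaL.
have : 0 <= rho * r k ^+ 3 by rewrite mulr_ge0 ?exprn_ge0 ?step_length_ge0.
move: (h (z k.+1)) (h (z k)) (r k) => u w t; lra.
Qed.

Lemma h_decreasing k : h (z k.+1) <= h (z k).
Proof.
apply: le_trans (h_descent k) _; rewrite gerBl.
by rewrite !mulr_ge0 ?exprn_ge0 ?step_length_ge0 ?invr_ge0 // ltW.
Qed.

Lemma h_le_start k : h (z k) <= h (z 0%N).
Proof.
by elim: k => [|k IH]; [exact: lexx | exact: (le_trans (h_decreasing k) IH)].
Qed.

Lemma ygrad_norm_sqr_le k : a k ^+ 2 <= 2 * mu * gap k.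
Proof. exact: h_reg_lower f_C3 mu_gt0 f_concave (z k) Phi_lb. Qed.

Lemma gap_ge0 k : 0 <= gap k.
Proof.
have := le_trans (sqr_ge0 (a k)) (ygrad_norm_sqr_le k).
by rewrite pmulr_rge0// mulr_gt0.
Qed.

Lemma ygrad_norm_le k : a k <= Num.sqrt (2 * mu * gap 0%N).
Proof.
rewrite -[leLHS]ger0_norm ?ygrad_norm_ge0// -sqrtr_sqr ler_sqrt; last first.
  by rewrite !mulr_ge0 ?gap_ge0// ltW.
apply: le_trans (ygrad_norm_sqr_le k) _.
apply: ler_wpM2l; first by rewrite mulr_ge0// ltW.
exact: (lerB (h_le_start k) (lexx _)).
Qed.

Lemma ygrad_norm_le_grad k : a k <= l2norm (grad h (z k)).
Proof. exact: l2norm_grad_y_le f_C3 mu_gt0 f_concave (z k). Qed.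

(** The factor |g_y(z_{k+1})| in the gradient bound is itself at most the gradient
    norm being estimated; when beta rho r <= 1 / 2 it is absorbed on the left. *)
Lemma grad_step_le k : beta * rho * r k <= 2^-1 ->
  l2norm (grad h (z k.+1)) <= 4 * beta * rho * r k * a k + 17 * kappa * rho * r k ^+ 2.
Proof.
move=> small.
have := grad_next_le f_C3 beta_ge0 L_ge0 rho_ge0 grad_lip hess_lip (@z_min k).
rewrite -z_next -/(r k) -/(a k) -/(a k.+1) -(mulrA (7 / 2)) betaL.
have := ygrad_norm_le_grad k.+1; set G := l2norm _ => aG.
have G0 : 0 <= G by exact: l2norm_ge0.
have h1 : beta * rho * r k * a k.+1 <= 2^-1 * G.
  by apply: ler_pM; rewrite ?ygrad_norm_ge0// !mulr_ge0 ?step_length_ge0 ?invr_ge0 ?ltW.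
have : 0 <= rho * r k ^+ 2 by rewrite mulr_ge0 ?exprn_ge0 ?step_length_ge0.
move=> /(ler_wpM2r) /(_ _ _ kappa_ge1); rewrite mul1r.
move: h1; move: (a k.+1) (a k) (r k) G {aG G0 small} => a' a0 t G; lra.
Qed.

Lemma hess_step_ge k v :
  - ((19 * kappa * rho * r k + beta * rho * (2 * a k + a k.+1)) * l2norm v ^+ 2)
  <= qform (hess h (z k.+1)) v.
Proof.
have := hess_next_ge f_C3 beta_ge0 L_ge0 rho_ge0 grad_lip hess_lip (@z_min k) v.
rewrite -z_next -/(r k) -/(a k) -/(a k.+1) -!(mulrA _ beta L) betaL.
apply: le_trans; rewrite lerN2 ler_wpM2r ?sqr_ge0//.
have : 0 <= rho * r k by rewrite mulr_ge0 ?step_length_ge0.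
move=> /(ler_wpM2r) /(_ _ _ kappa_ge1); rewrite mul1r.
move: (a k.+1) (a k) (r k) => a' a0 t; lra.
Qed.

Lemma SOSP_step k eps delta :
  l2norm (grad h (z k.+1)) <= eps ->
  19 * kappa * rho * r k + beta * rho * (2 * a k + a k.+1) <= delta ->
  is_SOSP h eps delta (z k.+1).
Proof.
move=> Geps le_delta; split=> // v.
rewrite qformD qformN qformN qform_scalar opprK.
rewrite -[leLHS](addNr (delta * l2norm v ^+ 2)) lerD2r.
apply: le_trans (hess_step_ge k v); rewrite lerN2.
exact: ler_wpM2r (sqr_ge0 _) _ _ le_delta.
Qed.

Local Notation sigma := (Num.sqrt (kappa * rho)).
Local Notation M := (beta * rho).
Local Notation w := (M / (10 * sigma)).
Local Notation A := (Num.sqrt (2 * mu * gap 0%N)).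
Local Notation E := (1 / 45 + w ^+ 2 * A).

Let kr_gt0 : 0 < kappa * rho. Proof. by rewrite mulr_gt0// divr_gt0. Qed.
Let sigma_gt0 : 0 < sigma. Proof. by rewrite sqrtr_gt0. Qed.
Let sigma_sqr : sigma ^+ 2 = kappa * rho. Proof. by rewrite sqr_sqrtr// ltW. Qed.
Let M_ge0 : 0 <= M. Proof. exact: mulr_ge0. Qed.
Let w_ge0 : 0 <= w. Proof. by rewrite divr_ge0// mulr_ge0// ltW. Qed.

(** The threshold s / (40 sigma) is small enough for the terms in kappa rho r^2 to
    take a fraction 17 / 40^2 < 1 / 90 of s^2 = eps. *)
Lemma short_step_grad_le k s : 0 <= s -> w * s <= 1 -> r k <= s / (40 * sigma) ->
  l2norm (grad h (z k.+1)) <= s ^+ 2 / 90 + w * s * a k.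
Proof.
move=> s0 ws rk; have rk0 := step_length_ge0 k.
have wE : M * (s / (40 * sigma)) = w * s / 4 by field; rewrite !gt_eqF.
have Mr : M * r k <= w * s / 4 by rewrite -wE; exact: ler_wpM2l.
have r2 : kappa * rho * r k ^+ 2 <= s ^+ 2 / 40 ^+ 2.
  have -> : s ^+ 2 / 40 ^+ 2 = kappa * rho * (s / (40 * sigma)) ^+ 2.
    by rewrite -{1}sigma_sqr; field; rewrite gt_eqF.
  by apply: ler_wpM2l; [exact: ltW | rewrite lerXn2r// nnegrE (le_trans rk0)].
apply: le_trans (grad_step_le _) _; first by apply: (le_trans Mr); lra.
have := ler_wpM2r (ygrad_norm_ge0 k) Mr; have := sqr_ge0 s.
move: Mr r2; move: (a k) (r k) w => a0 t q; lra.
Qed.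

(** Along the three steps a is bounded successively by A, O(s), E s^2 and s^2. *)
Lemma three_short_steps k s : 0 < s ->
  w * s <= 1 -> 2 * w * E * s <= 1 -> 2 * M * (2 * E + 1) / sigma * s <= 1 ->
  r k <= s / (40 * sigma) -> r k.+1 <= s / (40 * sigma) ->
  r k.+2 <= s / (40 * sigma) ->
  is_SOSP h (s ^+ 2) (sigma * s) (z k.+3).
Proof.
move=> s0 ws wE_s ME_s r0 r1 r2; have s0' := ltW s0.
have ws0 : 0 <= w * s by exact: mulr_ge0.
have s20 := sqr_ge0 s.
have a1 : a k.+1 <= s ^+ 2 / 90 + w * s * A.
  apply: le_trans (ygrad_norm_le_grad _) _.
  apply: le_trans (short_step_grad_le s0' ws r0) _.
  by apply: lerD => //; exact: ler_wpM2l (ygrad_norm_le k).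
have a2 : a k.+2 <= E * s ^+ 2.
  apply: le_trans (ygrad_norm_le_grad _) _.
  apply: le_trans (short_step_grad_le s0' ws r1) _.
  have := ler_wpM2l ws0 a1; have := ler_wpM2r s20 ws.
  move: (a k.+1) w A => a' q B; lra.
have G3 : l2norm (grad h (z k.+3)) <= s ^+ 2.
  apply: le_trans (short_step_grad_le s0' ws r2) _.
  exact: grad_bookkeeping s20 (ler_wpM2l ws0 a2) (ler_wpM2r s20 wE_s).
apply: SOSP_step => //.
have a3 := le_trans (ygrad_norm_le_grad _) G3.
have rr : kappa * rho * r k.+2 <= sigma * s / 40.
  have -> : sigma * s / 40 = kappa * rho * (s / (40 * sigma)).
    by rewrite -{2}sigma_sqr; field; rewrite gt_eqF.
  by apply: ler_wpM2l => //; exact: ltW.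
have MM : 2 * M * (2 * E + 1) * s <= sigma.
  move: ME_s; by rewrite mulrAC ler_pdivrMr// [1 * sigma]mul1r.
have ss0 : 0 <= sigma * s by rewrite mulr_ge0// ltW.
have -> : 19 * kappa * rho * r k.+2 = 19 * (kappa * rho * r k.+2) by rewrite !mulrA.
exact: hess_bookkeeping ss0 rr (ler_wpM2l M_ge0 a2) (ler_wpM2l M_ge0 a3) (ler_wpM2r s0' MM).
Qed.

(** Without any gap no descent is possible, so the first step has length 0 and all
    the a_k vanish. *)
Lemma SOSP_of_gap0 eps delta : 0 <= eps -> 0 <= delta -> gap 0%N = 0 ->
  is_SOSP h eps delta (z 1%N).
Proof.
move=> eps0 delta0 g0.
have r0 : r 0%N = 0.
  apply/eqP; suff : r 0%N ^+ 3 == 0 by rewrite expf_eq0.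
  rewrite eq_le exprn_ge0 ?step_length_ge0// andbT -(ler_pM2l kr_gt0) mulr0.
  have := h_descent 0; have := gap_ge0 1; move: g0.
  by move: (h (z 1%N)) (h (z 0%N)) (inf _) (r 0%N) => u v i t; lra.
have a0 k : a k = 0.
  apply/eqP; rewrite eq_le ygrad_norm_ge0 andbT.
  by apply: le_trans (ygrad_norm_le k) _; rewrite g0 mulr0 sqrtr0.
apply: SOSP_step; last by rewrite r0 !a0 !mulr0 add0r addr0 mulr0.
apply: le_trans (grad_step_le _) _; first by rewrite r0 mulr0 invr_ge0.
by rewrite r0 expr0n /= mulr0 mul0r mulr0 addr0.
Qed.

Lemma finds_SOSP s : 0 < s -> s <= 1 ->
  w * s <= 1 -> 2 * w * E * s <= 1 -> 2 * M * (2 * E + 1) / sigma * s <= 1 ->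
  (gap 0%N != 0 -> s <= sigma * gap 0%N) ->
  finds_within (Num.max 1 ((3 * 40 ^+ 3 + 3) * (sigma * gap 0%N * (s ^+ 3)^-1))) z
    (is_SOSP h (s ^+ 2) (sigma * s)).
Proof.
move=> s0 s1 ws wE_s ME_s gap_s.
have [g0|/gap_s {}gap_s] := eqVneq (gap 0%N) 0.
  exists 1%N; split=> //; first by rewrite le_max lexx.
  by apply: SOSP_of_gap0 => //; rewrite ?sqr_ge0// mulr_ge0// ltW.
set X := sigma * gap 0%N * (s ^+ 3)^-1.
have s30 : 0 < s ^+ 3 by exact: exprn_gt0.
have X1 : 1 <= X.
  rewrite /X ler_pdivlMr// mul1r; apply: le_trans gap_s.
  by rewrite exprS ler_piMr ?exprn_ile1// ltW.
pose tau := s / (40 * sigma).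
(* The decrease of h guaranteed by a step longer than tau. *)
pose delta := s ^+ 3 / (40 ^+ 3 * sigma).
have deltaE : kappa * rho * tau ^+ 3 = delta.
  by rewrite -{1}sigma_sqr /tau /delta; field; rewrite gt_eqF.
have drop k : tau < r k -> h (z k.+1) <= h (z k) - delta.
  move=> tr; apply: le_trans (h_descent k) _; rewrite lerD2l lerN2 -deltaE.
  apply: ler_wpM2l; first exact: ltW.
  rewrite lerXn2r ?nnegrE ?step_length_ge0// ltW//.
  by rewrite divr_gt0// mulr_gt0.
have good k : r k <= tau -> r k.+1 <= tau -> r k.+2 <= tau ->
    is_SOSP h (s ^+ 2) (sigma * s) (z k.+3) by exact: three_short_steps.
(* One more block than the gap can pay for; the bound X >= 1 absorbs rounding. *)
pose N := (Num.truncn (40 ^+ 3 * X)).+1.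
have X0 : 0 <= 40 ^+ 3 * X by rewrite mulr_ge0// (le_trans ler01 X1).
have [N1 N2] : N%:R <= 40 ^+ 3 * X + 1 /\ 40 ^+ 3 * X < N%:R.
  by split; rewrite /N ?truncnS_gt// -natr1 lerD2r truncn_le.
have [[k [k1 kN Qk]]|] := short_step_blocks
  (Q := fun k => is_SOSP h (s ^+ 2) (sigma * s) (z k)) N h_decreasing drop good.
  exists k; split=> //; rewrite le_max; apply/orP; right.
  apply: le_trans (_ : (3 * N)%:R <= _); first by rewrite ler_nat.
  by rewrite natrM; lra.
have := gap_ge0 (3 * N); have : 40 ^+ 3 * X * delta < N%:R * delta.
  by rewrite ltr_pM2r// divr_gt0// mulr_gt0.
have -> : 40 ^+ 3 * X * delta = gap 0%N.
  by rewrite /X /delta; field; rewrite !gt_eqF.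
by move: (h (z 0%N)) (h (z (3 * N)%N)) => u v; lra.
Qed.

End Convergence.

Theorem corollary3p10 (R : realType) :
  exists2 C : R, 0 < C &
  forall (n m : nat) (f : 'cV[R]_(n + m) -> R) (mu L rho : R)
         (z0 : 'cV[R]_(n + m)),
  (0 < m)%N ->
  0 < mu -> 0 < L -> 0 < rho ->
  contdiff 3 f ->
  (forall x : 'cV[R]_n,
     strongly_concave mu (fun y : 'cV[R]_m => f (col_mx x y))) ->
  (forall z xi : 'cV[R]_(n + m),
     l2norm (grad f (z + xi) - grad f z) <= L * l2norm xi) ->
  (forall z xi : 'cV[R]_(n + m),
     spectral_norm (hess f (z + xi) - hess f z) <= rho * l2norm xi) ->
  has_lbound (range (Phi f)) ->
  let beta := 2 * mu^-1 in
  let kappa := L / mu in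
  let Delta0 := h_reg beta f z0 - inf (range (Phi f)) in
  let alpha1 := 2 * beta * rho in
  let alpha2 := 2 * (3 * beta * L + 1) * rho in
  exists2 eps0 : R, 0 < eps0 &
  forall eps : R, 0 < eps < eps0 ->
  forall z : nat -> 'cV[R]_(n + m),
  z 0%N = z0 ->
  ACQRN beta alpha1 alpha2 f z ->
  finds_within
    (Num.max 1 (C * (Num.sqrt (kappa * rho) * Delta0 * eps `^ (- (3 / 2)))))
    z
    (is_SOSP (h_reg beta f) eps (Num.sqrt (kappa * rho * eps))).
Proof.
(* A block costs s^3 / (40^3 sigma), has three iterations, and one block is added
   by rounding up. *)
exists (3 * 40 ^+ 3 + 3); first by rewrite addr_gt0// mulr_gt0// exprn_gt0.
move=> n m f mu L rho z0 m0 mu0 L0 rho0 fC3 fconc glip hlip lb beta kappa D alpha1 alpha2.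
pose sigma := Num.sqrt (kappa * rho).
pose M := beta * rho.
pose w := M / (10 * sigma).
pose A := Num.sqrt (2 * mu * D).
pose E := 1 / 45 + w ^+ 2 * A.
have sigma0 : 0 < sigma by rewrite sqrtr_gt0 mulr_gt0// divr_gt0.
have M0 : 0 <= M by rewrite !mulr_ge0 ?invr_ge0 ?ltW.
have w0 : 0 <= w by rewrite divr_ge0// mulr_ge0// ltW.
have E0 : 0 <= E by rewrite addr_ge0// mulr_ge0 ?sqr_ge0 ?sqrtr_ge0.
(* 1 / K bounds sqrt eps: each summand is one of the smallness conditions, the last
   one being sqrt eps <= sigma D, where the inverse is 0 if D is 0. *)
pose K := 1 + w + 2 * w * E + 2 * M * (2 * E + 1) / sigma + `|(sigma * D)^-1|.
have t1 : 0 <= 2 * w * E := mulr_ge0 (mulr_ge0 (ler0n _ 2) w0) E0.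
have t2 : 0 <= 2 * M * (2 * E + 1) / sigma.
  apply: divr_ge0 (ltW sigma0); apply: mulr_ge0; first exact: mulr_ge0.
  by apply: addr_ge0 => //; exact: mulr_ge0.
have t3 : 0 <= `|(sigma * D)^-1| by exact: normr_ge0.
have K0 : 0 < K by rewrite /K; lra.
exists (K^-1 ^+ 2); first by rewrite exprn_gt0// invr_gt0.
move=> eps /andP[eps0 epsK] z zz0 zA.
pose s := Num.sqrt eps.
have s0 : 0 < s by rewrite sqrtr_gt0.
have s2 : s ^+ 2 = eps by rewrite sqr_sqrtr// ltW.
have sK : K * s <= 1.
  rewrite -ler_pdivlMl// mulr1 ltW//.
  by rewrite -ltr_sqr ?nnegrE ?invr_ge0 ?ltW// s2.
have le_s (c : R) : c <= K -> c * s <= 1.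
  by move=> cK; apply: le_trans sK; rewrite ler_pM2r.
have epsE : eps `^ (- (3 / 2)) = (s ^+ 3)^-1.
  rewrite powRN mulrC powRrM powR12_sqrt ?ltW//.
  by rewrite -/s powR_mulrn ?ltW.
have sqE : Num.sqrt (kappa * rho * eps) = sigma * s.
  by rewrite sqrtrM// mulr_ge0 ?divr_ge0 ?ltW.
have s1 : s <= 1 by rewrite -[s]mul1r; apply: le_s; rewrite /K; lra.
have ws : w * s <= 1 by apply: le_s; rewrite /K; lra.
have wEs : 2 * w * E * s <= 1 by apply: le_s; rewrite /K; lra.
have MEs : 2 * M * (2 * E + 1) / sigma * s <= 1 by apply: le_s; rewrite /K; lra.
have := finds_SOSP m0 mu0 L0 rho0 fC3 fconc glip hlip lb zA s0.
have := gap_ge0 z mu0 fC3 fconc lb 0.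
rewrite zz0 sqE epsE -s2 => D0; apply=> // Dn0.
have sD : 0 < sigma * D by rewrite mulr_gt0// lt_neqAle eq_sym Dn0.
rewrite -[leRHS]mul1r -ler_pdivrMr// mulrC; apply: le_s.
by rewrite (le_trans (ler_norm _))// /K; lra.
Qed.
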